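(* Let $M$ be an oriented closed connected manifold. Then for all but finitely many prime numbers $p \in \mathbb{N}$ we have $$\|M\|_{(\mathbb{F}_p)} = \|M\|_{(\mathbb{Q})}.$$
   Context: Closed means compact without boundary. Let $R$ be a commutative ring with unit and let $M$ be an oriented closed connected $n$-manifold. An $R$-fundamental cycle of $M$ is a singular cycle in $C_n(M;R)$ (singular chains with $R$-coefficients) representing the $R$-fundamental class $[M]_R \in H_n(M;R)$, the image of the integral fundamental class $[M]_{\mathbb{Z}}$ under the change of coefficients $\mathbb{Z}\to R$. The weightless $R$-simplicial volume of $M$ is $$\|M\|_{(R)} := \min\Bigl\{ m \in \mathbb{N} \Bigm| \sum_{j=1}^m a_j\cdot\sigma_j \in C_n(M;R) \text{ is an } R\text{-fundamental cycle of } M\Bigr\},$$ where $a_j\in R$ and the $\sigma_j\colon \Delta^n\to M$ are singular simplices. $\mathbb{F}_p$ is the field with $p$ elements. *)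

(* Defs.v *)
From HB Require Import structures.
From mathcomp Require Import all_boot all_order all_algebra.
From mathcomp Require Import all_classical all_reals all_analysis.
From mathcomp.multinomials Require Import freeg.
Set Implicit Arguments.
Unset Strict Implicit.
Unset Printing Implicit Defensive.
Import Order.TTheory GRing.Theory Num.Theory.
Import numFieldNormedType.Exports.
Local Open Scope classical_set_scope.
Local Open Scope ring_scope.

Definition homeomorphic (X Y : topologicalType) : Prop :=
  exists (f : continuousType X Y) (g : continuousType Y X),
    cancel f g /\ cancel g f.

Record closed_connected_manifold (R : realType) (n : nat) (M : topologicalType)
    : Prop := ClosedConnectedManifold {
  manifold_hausdorff : hausdorff_space M;
  manifold_second_countable : @second_countable M;
  (* charts are onto the whole of R^n, so there is no boundary *)
  manifold_locally_euclidean : forall x : M, exists2 U : set M,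
    open_nbhs x U & homeomorphic (set_type U) 'rV[R]_n;
  manifold_compact : compact [set: M];
  manifold_nonempty : [set: M] !=set0;
  manifold_connected : connected [set: M]
}.

Definition std_simplex (R : realType) (n : nat) : set 'rV[R]_n.+1 :=
  [set t | (forall i, 0 <= t 0 i) /\ \sum_i t 0 i = 1].
Arguments std_simplex : clear implicits.

(* The affine map sending the vertex e_j to e_(lift i j). *)
Definition face_row (R : realType) (n : nat) (i : 'I_n.+2) (t : 'rV[R]_n.+1)
    : 'rV[R]_n.+2 :=
  \row_k \sum_(j | fintype.lift i j == k) t 0 j.

Lemma face_row_simplex (R : realType) (n : nat) (i : 'I_n.+2)
    (t : set_type (std_simplex R n)) :
  face_row i (set_val t) \in std_simplex R n.+1.
Proof.
have [t0 t1] := set_mem (valP t); apply/mem_set; split=> [k|].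
  by rewrite mxE; apply: sumr_ge0.
rewrite -t1 (eq_bigr _ (fun k _ => mxE _ _ _ _)).
rewrite (exchange_big_dep predT) //=; apply: eq_bigr => j _.
by rewrite (big_pred1 (fintype.lift i j)) // => k; rewrite eq_sym.
Qed.

Definition face_map (R : realType) (n : nat) (i : 'I_n.+2)
    (t : set_type (std_simplex R n)) : set_type (std_simplex R n.+1) :=
  exist _ (face_row i (set_val t)) (face_row_simplex i t).

Lemma face_map_continuous (R : realType) (n : nat) (i : 'I_n.+2) :
  continuous (@face_map R n i).
Proof.
apply: continuous_comp_initial => t B [P Pk PB].
have Pt k : \forall u \near t, P 0 k (face_row i (set_val u) 0 k).
  have /(_ t) : continuous (fun u : set_type (std_simplex R n) =>
      \sum_(j | fintype.lift i j == k) set_val u 0 j).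
    apply: (@continuous_big R^o) => [|j _]; first exact: add_continuous.
    move=> u; apply: (@continuous_comp _ _ _ _ (fun M : 'rV[R]_n.+1 => M 0 j)).
      exact: initial_continuous.
    exact: coord_continuous.
  move=> sum_cvg; have := Pk 0 k; rewrite mxE => /sum_cvg sumP.
  by apply: (@filterS _ _ (nbhs_filter t) _ _ _ sumP) => u /=; rewrite mxE.
have Pforall := @filter_forall _ _ _ _ (nbhs_filter t) Pt.
apply: (@filterS _ _ (nbhs_filter t) _ _ _ Pforall) => u Pu; apply: PB.
by move=> a k; rewrite ord1; exact: Pu.
Qed.

HB.instance Definition _ (R : realType) (n : nat) (i : 'I_n.+2) :=
  isContinuous.Build _ _ (@face_map R n i) (@face_map_continuous R n i).

Definition singular_simplex (R : realType) (M : topologicalType) (n : nat) :=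
  continuousType (set_type (std_simplex R n)) M.

HB.instance Definition _ (R : realType) (M : topologicalType) (n : nat) :=
  Choice.on (singular_simplex R M n).

Definition face (R : realType) (M : topologicalType) (n : nat) (i : 'I_n.+2)
    (s : singular_simplex R M n.+1) : singular_simplex R M n :=
  (s \o face_map i : continuousType _ _).

Definition chain (R : realType) (M : topologicalType) (K : comNzRingType)
    (n : nat) :=
  {freeg (singular_simplex R M n) / K}.

Section Homology.
Context {R : realType} {M : topologicalType} {K : comNzRingType}.
Implicit Types (A : set M) (n : nat).

Definition boundary n (c : chain R M K n.+1) : chain R M K n :=
  fglift (fun s : singular_simplex R M n.+1 =>
    \sum_(i < n.+2) << (-1) ^+ i *g face i s >>) c.

Definition chain_in A n (c : chain R M K n) : Prop :=
  forall s : singular_simplex R M n, s \in dom c -> range s `<=` A.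

Definition is_cycle n : chain R M K n -> Prop :=
  match n with
  | 0 => fun _ => True
  | m.+1 => fun c => boundary c = 0
  end.

Definition homologous n (c c' : chain R M K n) : Prop :=
  exists b : chain R M K n.+1, c - c' = boundary b.

Definition is_relative_cycle A n : chain R M K n -> Prop :=
  match n with
  | 0 => fun _ => True
  | m.+1 => fun c => chain_in A (boundary c)
  end.

Definition relatively_homologous A n (c c' : chain R M K n) : Prop :=
  exists b : chain R M K n.+1, chain_in A (c - c' - boundary b).

(* On an n-manifold, for [A = ~` [set x]] and [K = int], the group H_n(M, A; K)
   is infinite cyclic, and this says that the class of [c] is one of its two
   generators. *)
Definition generates_relative_homology A n (c : chain R M K n) : Prop :=
  is_relative_cycle A c /\
  forall c', is_relative_cycle A c' ->
    exists k : K, relatively_homologous A c' (k *: c).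

End Homology.

(* A chain [o x] stands for its class in H_n(M, M \ {x}; Z); nothing below
   depends on the choice of the representatives. *)
Record is_orientation (R : realType) (n : nat) (M : topologicalType)
    (o : M -> chain R M int n) : Prop := IsOrientation {
  orientation_generator :
    forall x : M, generates_relative_homology (~` [set x]) (o x);
  orientation_locally_consistent :
    forall x : M, exists2 U : set M, nbhs x U &
      exists2 c : chain R M int n, is_relative_cycle (~` U) c &
        forall y, U y -> relatively_homologous (~` [set y]) c (o y)
}.

(* The integral cycles representing the class in H_n(M; Z) that restricts to
   the local orientation at every point. *)
Definition integral_fundamental_cycle (R : realType) (n : nat)
    (M : topologicalType) (o : M -> chain R M int n) (z : chain R M int n)
    : Prop :=
  is_cycle z /\ forall x, relatively_homologous (~` [set x]) z (o x).

Definition change_coefficients (R : realType) (n : nat) (M : topologicalType)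
    (K : comNzRingType) (c : chain R M int n) : chain R M K n :=
  \sum_(s <- dom c) << (coeff s c)%:~R *g s >>.

Definition fundamental_cycle (R : realType) (n : nat) (M : topologicalType)
    (o : M -> chain R M int n) (K : comNzRingType) (c : chain R M K n) : Prop :=
  is_cycle c /\
  exists2 z, integral_fundamental_cycle o z &
    homologous c (change_coefficients K z).

(* Coefficients may vanish and simplices may be repeated. *)
Definition has_fundamental_cycle_of_length (R : realType) (n : nat)
    (M : topologicalType) (o : M -> chain R M int n) (K : comNzRingType)
    (m : nat) : Prop :=
  exists (a : 'I_m -> K) (s : 'I_m -> singular_simplex R M n),
    fundamental_cycle o (\sum_(j < m) << a j *g s j >>).

(* The default value of [xget] is used only when there is no fundamental cycle,
   which does not happen on an oriented closed connected manifold. *)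
Definition weightless_simplicial_volume (R : realType) (n : nat)
    (M : topologicalType) (o : M -> chain R M int n) (K : comNzRingType) : nat :=
  xget 0%N [set m : nat | has_fundamental_cycle_of_length o K m /\
    forall m' : nat, has_fundamental_cycle_of_length o K m' -> (m <= m')%N].

(* Main.v *)
From HB Require Import structures.
From mathcomp Require Import all_boot all_order all_algebra.
From mathcomp Require Import all_classical all_reals all_analysis.
From mathcomp.multinomials Require Import freeg.
From mathcomp Require Import ring zify.
Require Import Defs.

(** If there is no integral fundamental cycle, there is none over any ring and
    all volumes agree. Otherwise the minimal numbers of simplices over [rat] and
    over ['F_p] are compared through integral cycles: both are lengths of integral
    chains homologous to a nonzero multiple of an integral fundamental cycle
    ([multiple_fundamental_cycle]), and such a chain, divided by the multiple,
    becomes a fundamental cycle over every field in which the multiple is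
    invertible ([fundamental_of_multiple]).

    From [rat] to ['F_p]: clearing the denominators of one minimal rational
    fundamental cycle and of the chain bounding its difference from the class
    gives such an integral chain, which works for every [p] that does not divide
    the common denominator ([multiple_of_rational]).

    From ['F_p] to [rat], for a fixed number [m] of simplices: whether a
    combination of [m] simplices is a cycle depends only on which of their faces
    coincide. This is one of finitely many patterns, and for each of them the
    cycle condition is a linear system with integer coefficients. By the Smith
    normal form the solutions mod [p] of such a system lift to integral solutions
    for all but finitely many [p] ([kernel_lift], [cycle_lift]). Hence a
    fundamental cycle over ['F_p] lifts to an integral cycle C on the same
    simplices, and C = z + boundary b + p e for an integral fundamental cycle z
    and an integral cycle e. If e is homologous to k z, then C is homologous to
    (1 + p k) z, and 1 + p k is not zero ([multiple_of_Fp]). Only the lengths m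
    below the rational volume matter, so finitely many primes are excluded.

    The topological input is that every integral n-cycle e is homologous to a
    multiple of z ([cycle_multiple_fundamental]). At one point x the class of e
    in H_n(M, M - x) is k times that of z because the orientation generates this
    group, so it remains to see that an n-cycle whose class vanishes at one point
    is a boundary ([cycle_vanishing_somewhere]). Here M is covered by cells:
    images B, in charts, of simplices homothetic to a standard one. The complement
    in R^n of such a simplex is a union of n + 1 open half-spaces, so the relative
    Mayer-Vietoris argument ([mayer_vietoris]) reduces its homology to that of
    convex sets. It yields that H_k(M - x, M - B) = 0 for x in B and all k, since
    a point and a simplex have complements with the same nerve; and that
    H_k(M, M - B) = 0 for k > n, since n + 1 sets have a nerve of small dimension.
    By the first statement, vanishing at a point is an open and closed condition,
    and vanishing at one point of a cell implies vanishing on the whole cell. By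
    the second, extended from cells to all their closed subsets, vanishing on
    finitely many cells implies vanishing on their union
    ([bounds_mod_setI]), which is M in the end.

    Mayer-Vietoris rests on the decomposition of a chain in a union of two open
    sets, up to homotopy, into chains in each of them ([small_deformation]), that
    is on iterated barycentric subdivision. Subdivision is defined on affine
    chains, where a simplex is the matrix of its vertices and affine maps are right
    multiplications, and is transported to singular chains by naturality. *)

Set Implicit Arguments.
Unset Strict Implicit.
Unset Printing Implicit Defensive.
Import Order.TTheory GRing.Theory Num.Theory.
Import numFieldNormedType.Exports.
Local Open Scope classical_set_scope.
Local Open Scope ring_scope.

(** * Free modules *)

Section FreeModule.
Context {K : nzRingType} {S : choiceType}.
Implicit Types (c d : {freeg S / K}) (P : S -> Prop).

Lemma fglift_linear (V : lmodType K) (f : S -> V) : linear (fglift f).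
Proof.
have fD c d : fglift f (c + d) = fglift f c + fglift f d.
  have fB := @lift_is_additive K S V f.
  have f0 : fglift f 0 = 0 by rewrite -{1}(subrr 0) fB subrr.
  by rewrite -{1}[d]opprK -[- d]sub0r !fB f0 sub0r opprK.
move=> k c d; rewrite fD; congr (_ + _).
elim/freeg_ind_dom0: c => [|a s c _ _ IHc].
  have f0 : fglift f 0 = 0 by apply: (addrI (fglift f 0)); rewrite -fD !addr0.
  by rewrite scaler0 f0 scaler0.
rewrite scalerDr !fD IHc scalerDr; congr (_ + _).
suff -> : k *: << a *g s >> = << k * a *g s >> :> {freeg S / K}.
  by rewrite !liftU scalerA.
by apply/eqP/freeg_eqP => t; rewrite coeffZ !coeffU mulrA.
Qed.

HB.instance Definition _ (V : lmodType K) (f : S -> V) :=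
  GRing.isLinear.Build K {freeg S / K} V *:%R (fglift f) (fglift_linear f).

Lemma freegUZ (k : K) (s : S) : << k *g s >> = k *: << s >> :> {freeg S / K}.
Proof. by apply/eqP/freeg_eqP => t; rewrite coeffZ !coeffU mul1r. Qed.

Lemma fgliftU (V : lmodType K) (f : S -> V) (s : S) : fglift f << s >> = f s.
Proof. by rewrite liftU scale1r. Qed.

Lemma freeg_lin_ind (Q : {freeg S / K} -> Prop) :
  Q 0 -> (forall c d, Q c -> Q d -> Q (c + d)) ->
  (forall k c, Q c -> Q (k *: c)) -> (forall s, Q << s >>) -> forall c, Q c.
Proof.
move=> Q0 QD QZ QU; elim/freeg_ind_dom0 => // k s c _ _ Qc.
by apply: QD => //; rewrite freegUZ; exact: QZ.
Qed.

Lemma linear_freeg_eq (V : lmodType K) (f g : {linear {freeg S / K} -> V}) :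
  (forall s, f << s >> = g << s >>) -> f =1 g.
Proof.
move=> fg; elim/freeg_lin_ind => [|c d fc fd|k c fc|//].
- by rewrite !linear0.
- by rewrite !linearD fc fd.
- by rewrite !linearZ fc.
Qed.

Definition supported P c := forall s, coeff s c != 0 -> P s.

Lemma supported0 P : supported P 0.
Proof. by move=> s; rewrite coeff0 eqxx. Qed.

Lemma supportedD P c d : supported P c -> supported P d -> supported P (c + d).
Proof.
move=> Pc Pd s; rewrite coeffD; have [c0|] := eqVneq (coeff s c) 0.
  by rewrite c0 add0r => /Pd.
by move=> /Pc.
Qed.

Lemma supportedZ P k c : supported P c -> supported P (k *: c).
Proof.
move=> Pc s; rewrite coeffZ; have [->|/Pc//] := eqVneq (coeff s c) 0.
by rewrite mulr0 eqxx.
Qed.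

Lemma supportedN P c : supported P c -> supported P (- c).
Proof. by rewrite -scaleN1r; exact: supportedZ. Qed.

Lemma supportedB P c d : supported P c -> supported P d -> supported P (c - d).
Proof. by move=> Pc Pd; apply: supportedD => //; exact: supportedN. Qed.

Lemma supportedU P s : P s -> supported P << s >>.
Proof.
move=> Ps t; rewrite coeffU mul1r; case: (eqVneq s t) => [<-//|_].
by rewrite eqxx.
Qed.

Lemma supported_sum P (I : Type) (r : seq I) (Q : pred I)
    (F : I -> {freeg S / K}) :
  (forall i, Q i -> supported P (F i)) -> supported P (\sum_(i <- r | Q i) F i).
Proof.
by move=> PF; elim/big_ind: _ => //; [exact: supported0|exact: supportedD].
Qed.

Lemma supported_sub P P' c :
  (forall s, P s -> P' s) -> supported P c -> supported P' c.
Proof. by move=> PP' Pc s /Pc/PP'. Qed.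

Lemma supported_ind P (Q : {freeg S / K} -> Prop) :
  Q 0 -> (forall c d, Q c -> Q d -> Q (c + d)) ->
  (forall k c, Q c -> Q (k *: c)) -> (forall s, P s -> Q << s >>) ->
  forall c, supported P c -> Q c.
Proof.
move=> Q0 QD QZ QU c Pc; rewrite -[c]freeg_sumE big_seq.
elim/big_ind: _ => // s; rewrite mem_dom => /Pc Ps.
by rewrite freegUZ; apply/QZ/QU.
Qed.

Lemma linear_freeg_eq_on P (V : lmodType K) (f g : {linear {freeg S / K} -> V}) c :
  (forall s, P s -> f << s >> = g << s >>) -> supported P c -> f c = g c.
Proof.
move=> fg; move: c; apply: supported_ind => [|c d fc fd|k c fc|//].
- by rewrite !linear0.
- by rewrite !linearD fc fd.
- by rewrite !linearZ fc.
Qed.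

Lemma supported_split P P' c : supported (fun s => P s \/ P' s) c ->
  exists c1 c2, [/\ c = c1 + c2, supported P c1 & supported P' c2].
Proof.
move: c; apply: supported_ind.
- by exists 0, 0; rewrite addr0; split => //; exact: supported0.
- move=> c d [c1 [c2 [-> Pc1 Pc2]]] [d1 [d2 [-> Pd1 Pd2]]].
  by exists (c1 + d1), (c2 + d2); split; [rewrite addrACA|exact: supportedD..].
- move=> k c [c1 [c2 [-> Pc1 Pc2]]].
  by exists (k *: c1), (k *: c2); split; [rewrite scalerDr|exact: supportedZ..].
- move=> s [Ps|Ps]; [exists << s >>, 0|exists 0, << s >>].
    by rewrite addr0; split; [|exact: supportedU|exact: supported0].
  by rewrite add0r; split; [|exact: supported0|exact: supportedU].
Qed.

End FreeModule.

Lemma supported_lift (K : nzRingType) (S S' : choiceType) (P : S -> Prop)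
    (P' : S' -> Prop) (F : S -> {freeg S' / K}) c :
  (forall s, P s -> supported P' (F s)) -> supported P c ->
  supported P' (fglift F c).
Proof.
move=> PF; move: c; apply: supported_ind => [|c d Pc Pd|k c Pc|s Ps].
- by rewrite linear0; exact: supported0.
- by rewrite linearD; exact: supportedD.
- by rewrite linearZ; exact: supportedZ.
- by rewrite fgliftU; exact: PF.
Qed.

(** * Affine chains *)

Section AffineChains.
Context {R : realFieldType} {K : comNzRingType}.
Implicit Types (k N : nat).

Definition affine_chain k N := {freeg 'M[R]_(k, N) / K}.

(** The matrix rows are the vertices, so the complex is augmented: it ends with
    the matrix without rows, below the vertices. *)
Definition affine_boundary {k N} : affine_chain k.+1 N -> affine_chain k N :=
  fglift (fun V : 'M[R]_(k.+1, N) =>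
    \sum_(i < k.+1) << (-1) ^+ i *g (row' i V : 'M[R]_(k, N)) >>).

HB.instance Definition _ k N := GRing.Linear.copy (@affine_boundary k N)
  (fglift (fun V : 'M[R]_(k.+1, N) =>
    \sum_(i < k.+1) << (-1) ^+ i *g (row' i V : 'M[R]_(k, N)) >>)).

Definition affine_cone {k N} (b : 'rV[R]_N) : affine_chain k N -> affine_chain k.+1 N :=
  fglift (fun V => << (col_mx b V : 'M[R]_(k.+1, N)) >>).

HB.instance Definition _ k N b := GRing.Linear.copy (@affine_cone k N b)
  (fglift (fun V => << (col_mx b V : 'M[R]_(k.+1, N)) >>)).

Definition affine_map {k N N'} (A : 'M[R]_(N, N')) :
    affine_chain k N -> affine_chain k N' :=
  fglift (fun V => << V *m A >>).

HB.instance Definition _ k N N' A := GRing.Linear.copy (@affine_map k N N' A)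
  (fglift (fun V => << V *m A >>)).

Definition barycenter k N (V : 'M[R]_(k, N)) : 'rV[R]_N :=
  k%:R^-1 *: \sum_i row i V.

(** A simplex is subdivided into the cones from its barycenter over the
    subdivided boundary. *)
Fixpoint subdivision {k N} : affine_chain k N -> affine_chain k N :=
  match k with
  | 0 => id
  | k'.+1 => fglift (fun V : 'M[R]_(k'.+1, N) =>
      affine_cone (barycenter V) (subdivision (affine_boundary << V >>)))
  end.

Lemma subdivision_linear k N : linear (@subdivision k N).
Proof. by case: k => [|k] //=; exact: fglift_linear. Qed.

HB.instance Definition _ k N := GRing.isLinear.Build K _ _ *:%R
  (@subdivision k N) (@subdivision_linear k N).

Fixpoint subdivision_htpy {k N} : affine_chain k N -> affine_chain k.+1 N :=
  match k with
  | 0 => fun=> 0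
  | k'.+1 => fglift (fun V : 'M[R]_(k'.+1, N) => affine_cone (barycenter V)
      (<< V >> - subdivision_htpy (affine_boundary << V >>)))
  end.

Lemma subdivision_htpy_linear k N : linear (@subdivision_htpy k N).
Proof.
case: k => [|k] /=; last exact: fglift_linear.
by move=> a c d; rewrite scaler0 addr0.
Qed.

HB.instance Definition _ k N := GRing.isLinear.Build K _ _ *:%R
  (@subdivision_htpy k N) (@subdivision_htpy_linear k N).

Arguments subdivision : simpl never.
Arguments subdivision_htpy : simpl never.

Lemma affine_boundaryU k N (V : 'M[R]_(k.+1, N)) :
  affine_boundary << V >> =
  \sum_(i < k.+1) (-1) ^+ i *: << (row' i V : 'M[R]_(k, N)) >>.
Proof.
by rewrite /affine_boundary fgliftU; apply: eq_bigr => i _; exact: freegUZ.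
Qed.

Lemma affine_coneU k N b (V : 'M[R]_(k, N)) :
  affine_cone b << V >> = << (col_mx b V : 'M[R]_(k.+1, N)) >>.
Proof. exact: fgliftU. Qed.

Lemma affine_mapU k N N' (A : 'M[R]_(N, N')) (V : 'M[R]_(k, N)) :
  affine_map A << V >> = << V *m A >>.
Proof. exact: fgliftU. Qed.

Lemma subdivisionU k N (V : 'M[R]_(k.+1, N)) : subdivision << V >> =
  affine_cone (barycenter V) (subdivision (affine_boundary << V >>)).
Proof. exact: fgliftU. Qed.

Lemma subdivision_htpyU k N (V : 'M[R]_(k.+1, N)) : subdivision_htpy << V >> =
  affine_cone (barycenter V)
    (<< V >> - subdivision_htpy (affine_boundary << V >>)).
Proof. exact: fgliftU. Qed.

Lemma row'_col_mx0 k N (b : 'rV[R]_N) (V : 'M[R]_(k, N)) :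
  row' (ord0 : 'I_k.+1) (col_mx b V) = V.
Proof.
apply/matrixP => i j; rewrite mxE.
have -> : fintype.lift (ord0 : 'I_k.+1) i = rshift 1 i.
  exact/val_inj.
by rewrite (col_mxEd b V).
Qed.

Lemma row'_col_mxS k N (b : 'rV[R]_N) (V : 'M[R]_(k.+1, N)) (i : 'I_k.+1) :
  row' (fintype.lift ord0 i : 'I_k.+2) (col_mx b V) =
  (col_mx b (row' i V : 'M[R]_(k, N)) : 'M[R]_(k.+1, N)).
Proof.
apply/matrixP => j l; rewrite mxE; case: (unliftP ord0 j) => [j'|] ->.
  have -> : fintype.lift (fintype.lift ord0 i : 'I_k.+2)
      (fintype.lift (ord0 : 'I_k.+1) j') = rshift 1 (fintype.lift i j').
    by apply/val_inj; rewrite /= /bump /=; lia.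
  have -> : fintype.lift (ord0 : 'I_k.+1) j' = rshift 1 j' by exact/val_inj.
  by rewrite !(col_mxEd b) mxE.
have -> : fintype.lift (fintype.lift ord0 i : 'I_k.+2) (ord0 : 'I_k.+1) =
    (lshift k.+1 (ord0 : 'I_1) : 'I_(1 + k.+1)) by exact/val_inj.
have -> : (ord0 : 'I_k.+1) = (lshift k (ord0 : 'I_1) : 'I_(1 + k)) by exact/val_inj.
by rewrite !(col_mxEu b).
Qed.

(** The face opposite to the apex is the simplex itself; the other faces are
    the cones over its faces. *)
Lemma boundary_cone k N b (c : affine_chain k.+1 N) :
  affine_boundary (affine_cone b c) = c - affine_cone b (affine_boundary c).
Proof.
move: c; refine (linear_freeg_eq (f := affine_boundary \o affine_cone b)
  (g := idfun \- (affine_cone b \o affine_boundary)) _); move=> V /=.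
rewrite affine_coneU affine_boundaryU big_ord_recl expr0 scale1r row'_col_mx0.
congr (_ + _); rewrite affine_boundaryU linear_sum -sumrN.
apply: eq_bigr => i _; rewrite linearZ /= affine_coneU row'_col_mxS.
by rewrite exprS mulN1r scaleNr.
Qed.

Lemma boundary_cone0 N b (c : affine_chain 0 N) :
  affine_boundary (affine_cone b c) = c.
Proof.
move: c; refine (linear_freeg_eq (f := affine_boundary \o affine_cone b)
  (g := idfun) _); move=> V /=.
by rewrite affine_coneU affine_boundaryU big_ord1 expr0 scale1r row'_col_mx0.
Qed.

Lemma col_mx_cone k N (V : 'M[R]_(k.+1, N)) :
  exists b (V' : 'M[R]_(k, N)), << V >> = affine_cone b << V' >>.
Proof.
exists (usubmx (V : 'M[R]_(1 + k, N))), (dsubmx (V : 'M[R]_(1 + k, N))).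
by rewrite affine_coneU (@vsubmxK R 1 k N).
Qed.

(** Every simplex is the cone from its first vertex over the opposite face, so
    the cone formula gives an induction that avoids the double sum over faces. *)
Lemma affine_boundary_boundary k N (c : affine_chain k.+2 N) :
  affine_boundary (affine_boundary c) = 0.
Proof.
elim: k c => [|k IHk] c; move: c;
  refine (linear_freeg_eq (f := affine_boundary \o affine_boundary)
    (g := \0) _); move=> V /=; have [b [V' ->]] := col_mx_cone V.
  by rewrite boundary_cone linearB /= boundary_cone0 subrr.
by rewrite boundary_cone linearB /= boundary_cone IHk linear0 subr0 subrr.
Qed.

Lemma subdivision_boundary k N (c : affine_chain k.+1 N) :
  affine_boundary (subdivision c) = subdivision (affine_boundary c).
Proof.
elim: k c => [|k IHk] c; move: c;
  refine (linear_freeg_eq (f := affine_boundary \o subdivision)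
    (g := subdivision \o affine_boundary) _); move=> V /=.
  by rewrite subdivisionU boundary_cone0.
rewrite subdivisionU boundary_cone.
by rewrite IHk affine_boundary_boundary !linear0 addr0.
Qed.

Lemma subdivision_homotopy k N (c : affine_chain k.+1 N) :
  affine_boundary (subdivision_htpy c) + subdivision_htpy (affine_boundary c) =
  c - subdivision c.
Proof.
elim: k c => [|k IHk] c; move: c; refine (linear_freeg_eq
    (f := (affine_boundary \o subdivision_htpy) \+
          (subdivision_htpy \o affine_boundary))
    (g := idfun \- subdivision) _); move=> V.
  rewrite [LHS]/= subdivision_htpyU [RHS]/= subdivisionU.
  by rewrite boundary_cone !subr0 addr0.
change (affine_boundary (subdivision_htpy << V >>) +
  subdivision_htpy (affine_boundary << V >>) = << V >> - subdivision << V >>).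
rewrite subdivision_htpyU subdivisionU boundary_cone linearB /=.
set dV := affine_boundary _; have hdV : affine_boundary dV = 0.
  exact: affine_boundary_boundary.
have := IHk dV; rewrite hdV linear0 addr0 => ->.
by rewrite subKr addrAC subrK.
Qed.

Lemma boundary_map k N N' (A : 'M[R]_(N, N')) (c : affine_chain k.+1 N) :
  affine_boundary (affine_map A c) = affine_map A (affine_boundary c).
Proof.
move: c; refine (linear_freeg_eq (f := affine_boundary \o affine_map A)
  (g := affine_map A \o affine_boundary) _); move=> V /=.
rewrite affine_mapU !affine_boundaryU linear_sum; apply: eq_bigr => i _.
rewrite linearZ /= affine_mapU; congr (_ *: << _ >>).
by apply/matrixP => a b; rewrite !mxE; apply: eq_bigr => j _; rewrite mxE.
Qed.

Lemma cone_map k N N' (A : 'M[R]_(N, N')) b (c : affine_chain k N) :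
  affine_map A (affine_cone b c) = affine_cone (b *m A) (affine_map A c).
Proof.
move: c; refine (linear_freeg_eq (f := affine_map A \o affine_cone b)
  (g := affine_cone (b *m A) \o affine_map A) _); move=> V /=.
rewrite affine_coneU !affine_mapU affine_coneU.
by congr (<< _ >>); rewrite -(mul_col_mx b V A).
Qed.

Lemma barycenter_map k N N' (A : 'M[R]_(N, N')) (V : 'M[R]_(k, N)) :
  barycenter (V *m A) = barycenter V *m A.
Proof.
rewrite /barycenter -scalemxAl mulmx_suml; congr (_ *: _).
by apply: eq_bigr => i _; rewrite row_mul.
Qed.

(** Cones, barycenters and boundaries commute with affine maps; this is what
    allows subdividing a singular simplex through its model. *)
Lemma subdivision_map k N N' (A : 'M[R]_(N, N')) (c : affine_chain k N) :
  subdivision (affine_map A c) = affine_map A (subdivision c).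
Proof.
elim: k c => [//|k IHk]; refine (linear_freeg_eq
  (f := subdivision \o affine_map A)
  (g := affine_map A \o subdivision) _); move=> V.
change (subdivision (affine_map A << V >>) = affine_map A (subdivision << V >>)).
rewrite affine_mapU !subdivisionU cone_map barycenter_map.
by rewrite -affine_mapU boundary_map IHk.
Qed.

Lemma subdivision_htpy_map k N N' (A : 'M[R]_(N, N')) (c : affine_chain k N) :
  subdivision_htpy (affine_map A c) = affine_map A (subdivision_htpy c).
Proof.
elim: k c => [c|k IHk]; first by rewrite /= linear0.
refine (linear_freeg_eq
  (f := subdivision_htpy \o affine_map A)
  (g := affine_map A \o subdivision_htpy) _); move=> V.
change (subdivision_htpy (affine_map A << V >>) =
  affine_map A (subdivision_htpy << V >>)).
rewrite affine_mapU !subdivision_htpyU cone_map.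
by rewrite barycenter_map [affine_map A (_ - _)]linearB /= affine_mapU
  -IHk -boundary_map affine_mapU.
Qed.

End AffineChains.
Arguments affine_chain : clear implicits.

(** * Convexity and mesh of subdivisions *)

Section SubdivisionMesh.
Context {R : realFieldType} {K : comNzRingType}.
Implicit Types (k N : nat).

Definition rows_in N (C : 'rV[R]_N -> Prop) {k} (V : 'M[R]_(k, N)) :=
  forall i, C (row i V).

(** All that is needed of a convex set: the vertices that subdivision creates
    are averages of old vertices. *)
Definition average_closed N (C : 'rV[R]_N -> Prop) :=
  forall k (V : 'M[R]_(k.+1, N)), rows_in C V -> C (barycenter V).

Lemma barycenterE N k (V : 'M[R]_(k, N)) l :
  barycenter V 0 l = k%:R^-1 * \sum_i V i l.
Proof.
by rewrite !mxE summxE; congr (_ * _); apply: eq_bigr => i _; rewrite mxE.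
Qed.

Lemma rows_in_cone N (C : 'rV[R]_N -> Prop) k (b : 'rV[R]_N) (V : 'M[R]_(k, N)) :
  C b -> rows_in C V -> rows_in C (col_mx b V).
Proof.
move=> Cb CV i; case: (split_ordP i) => j ->; last by rewrite rowKd; exact: CV.
by rewrite rowKu row_id.
Qed.

Lemma supported_cone N (C : 'rV[R]_N -> Prop) k b (c : affine_chain R K k N) :
  C b -> supported (rows_in C) c ->
  supported (rows_in (k := k.+1) C) (affine_cone b c).
Proof.
move=> Cb; apply: supported_lift => V CV.
by apply: supportedU; exact: (rows_in_cone Cb CV).
Qed.

Lemma supported_affine_boundary N (C : 'rV[R]_N -> Prop) k
    (c : affine_chain R K k.+1 N) :
  supported (rows_in C) c -> supported (rows_in C) (affine_boundary c).
Proof.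
apply: supported_lift => V CV; apply: supported_sum => i _.
rewrite freegUZ; apply: supportedZ; apply: supportedU => j.
by rewrite row_rowsub; exact: CV.
Qed.

Lemma supported_subdivision N (C : 'rV[R]_N -> Prop) k
    (c : affine_chain R K k N) : average_closed C ->
  supported (rows_in C) c -> supported (rows_in C) (subdivision c).
Proof.
move=> avgC; elim: k c => [//|k IHk] c; apply: supported_lift => V CV.
apply: supported_cone; first exact: avgC.
by apply: IHk; apply: supported_affine_boundary; exact: supportedU.
Qed.

Lemma supported_subdivision_htpy N (C : 'rV[R]_N -> Prop) k
    (c : affine_chain R K k N) : average_closed C ->
  supported (rows_in C) c -> supported (rows_in C) (subdivision_htpy c).
Proof.
move=> avgC; elim: k c => [c _|k IHk c]; first exact: supported0.
apply: supported_lift => V CV; apply: supported_cone; first exact: avgC.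
apply: supportedB; first exact: supportedU.
by apply: IHk; apply: supported_affine_boundary; exact: supportedU.
Qed.

(** The diameter is measured one coordinate at a time, where the convex hull of
    the vertices is an interval. *)
Definition oscillation_le N k (l : 'I_N) (d : R) (V : 'M[R]_(k, N)) :=
  forall i j, `|V i l - V j l| <= d.

Lemma average_closed_itv N (l : 'I_N) (lo hi : R) :
  average_closed (fun x : 'rV[R]_N => lo <= x 0 l <= hi).
Proof.
move=> k V CV; rewrite barycenterE.
have CV' i : lo <= V i l <= hi by have := CV i; rewrite mxE.
have kE (a : R) : a = k.+1%:R^-1 * \sum_(i < k.+1) a.
  by rewrite sumr_const card_ord -[a *+ _]mulr_natl mulKf ?pnatr_eq0.
rewrite [X in X <= _ <= _](kE lo) [X in _ <= _ <= X](kE hi) !ler_pM2l ?invr_gt0 ?ltr0n //.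
by apply/andP; split; apply: ler_sum => i _; have /andP[] := CV' i.
Qed.

(** The difference is an average of the k + 1 differences V_i - V_j, and the one
    with i = j is zero; hence the factor k / (k + 1). *)
Lemma barycenter_dist N k (l : 'I_N) d (V : 'M[R]_(k.+1, N)) j :
  oscillation_le l d V ->
  `|barycenter V 0 l - V j l| <= k%:R / k.+1%:R * d.
Proof.
move=> oscV; rewrite barycenterE.
have -> : k.+1%:R^-1 * \sum_i V i l - V j l =
    k.+1%:R^-1 * \sum_(i < k.+1) (V i l - V j l).
  rewrite sumrB sumr_const card_ord -[V j l *+ _]mulr_natl mulrBr.
  by rewrite mulKf ?pnatr_eq0.
rewrite normrM gtr0_norm ?invr_gt0 ?ltr0n // [leRHS]mulrAC [leRHS]mulrC.
rewrite ler_pM2l ?invr_gt0 ?ltr0n //.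
rewrite (bigD1 j) //= subrr add0r; apply: (le_trans (ler_norm_sum _ _ _)).
apply: (@le_trans _ _ (\sum_(i < k.+1 | i != j) d)); first exact: ler_sum.
by rewrite sumr_const cardC1 card_ord mulr_natl.
Qed.

(** An edge of a subdivided simplex either lies in a subdivided proper face, where
    the ratio for smaller dimension applies, or joins the barycenter to a point
    of the convex hull of the vertices. *)
Lemma subdivision_oscillation N k (l : 'I_N) d (V : 'M[R]_(k.+1, N)) :
  oscillation_le l d V ->
  supported (oscillation_le l (k%:R / k.+1%:R * d))
    (subdivision (<< V >> : affine_chain R K k.+1 N)).
Proof.
elim: k V => [|k IHk] V oscV.
  rewrite subdivisionU; apply: (@supported_lift _ _ _ (fun=> True)) => // W _.
  apply: supportedU => i j; rewrite !ord1 subrr normr0.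
  by rewrite mul0r mul0r.
have d0 : 0 <= d by exact: le_trans (normr_ge0 _) (oscV ord0 ord0).
set e := _ * d; have e0 : 0 <= e by rewrite !mulr_ge0 ?invr_ge0 ?ler0n.
rewrite subdivisionU; set b := barycenter V.
pose C (x : 'rV[R]_N) := b 0 l - e <= x 0 l <= b 0 l + e.
have CV : rows_in C V.
  by move=> i; rewrite /C [row i V 0 l]mxE -ler_distlC; exact: barycenter_dist.
apply: (@supported_lift _ _ _ (fun W => oscillation_le l e W /\ rows_in C W)).
  move=> W [oscW CW]; apply: supportedU => i j.
  have bW m : `|b 0 l - W m l| <= e.
    by have := CW m; rewrite /C [row m W 0 l]mxE -ler_distlC.
  case: (@split_ordP 1 k.+1 i) => i' ->; case: (@split_ordP 1 k.+1 j) => j' ->.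
  - by rewrite !(@col_mxEu R 1) !ord1 subrr normr0.
  - by rewrite (@col_mxEu R 1) (@col_mxEd R 1) ord1.
  - by rewrite (@col_mxEu R 1) (@col_mxEd R 1) ord1 distrC.
  - by rewrite !(@col_mxEd R 1).
move=> W cW; split; last first.
  move: W cW; apply: supported_subdivision; first exact: average_closed_itv.
  by apply: supported_affine_boundary; exact: supportedU.
move: W cW; apply: (@supported_lift _ _ _ (oscillation_le l d)) => [W oscW|].
  have sW : supported (oscillation_le l (k%:R / k.+1%:R * d))
    (subdivision (<< W >> : affine_chain R K _ N)) by exact: IHk.
  rewrite subdivisionU in sW; move: sW; apply: supported_sub => U oscU i j.
  apply: le_trans (oscU i j) _; rewrite ler_wpM2r // ler_pdivrMr ?ltr0n //.
  rewrite mulrAC ler_pdivlMr ?ltr0n // -!natrM ler_nat; nia.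
rewrite affine_boundaryU; apply: supported_sum => i _.
apply: supportedZ; apply: supportedU => m m'; rewrite !mxE; exact: oscV.
Qed.

Lemma iter_subdivision_oscillation N k (l : 'I_N) d (V : 'M[R]_(k.+1, N)) j :
  oscillation_le l d V ->
  supported (oscillation_le l ((k%:R / k.+1%:R) ^+ j * d))
    (iter j subdivision (<< V >> : affine_chain R K k.+1 N)).
Proof.
move=> oscV; elim: j => [|j IHj]; first by rewrite expr0 mul1r; exact: supportedU.
rewrite iterS exprS -mulrA; move: IHj; apply: supported_lift => W oscW.
by rewrite -subdivisionU; exact: subdivision_oscillation.
Qed.

End SubdivisionMesh.

(** * Singular simplices as restrictions of maps on Euclidean space *)

Section Simplices.
Context {R : realType}.
Implicit Types (n : nat).

Lemma for_continuousD (T : topologicalType) (V : normedModType R) (f g : T -> V) x :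
  continuous_at x f -> continuous_at x g ->
  continuous_at x (fun t => f t + g t).
Proof. exact: cvgD. Qed.

Lemma for_continuousB (T : topologicalType) (V : normedModType R) (f g : T -> V) x :
  continuous_at x f -> continuous_at x g ->
  continuous_at x (fun t => f t - g t).
Proof. exact: cvgB. Qed.

Lemma for_continuousM (T : topologicalType) (f g : T -> R) x :
  continuous_at x f -> continuous_at x g ->
  continuous_at x (fun t => f t * g t).
Proof. exact: cvgM. Qed.

Lemma for_continuous_cst (T U : topologicalType) (a : U) (x : T) :
  continuous_at x (fun=> a).
Proof. exact: cst_continuous. Qed.

Lemma continuous_at_row (T : topologicalType) n (f : T -> 'rV[R]_n) x :
  (forall k, continuous_at x (fun t => f t 0 k)) ->
  continuous_at x f.
Proof.
move=> cf B [P Pk PB].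
have Pt k : \forall u \near x, P 0 k (f u 0 k) by exact: cf.
have := @filter_forall _ _ _ _ (nbhs_filter x) Pt.
apply: filterS => u Pu; apply: PB => a k; rewrite ord1; exact: Pu.
Qed.

Lemma continuous_row (T : topologicalType) n (f : T -> 'rV[R]_n) :
  (forall k, continuous (fun t => f t 0 k)) -> continuous f.
Proof. by move=> cf x; apply: continuous_at_row => k; exact: cf. Qed.

Lemma continuous_coord n k : continuous (fun x : 'rV[R]_n => x 0 k).
Proof. exact: coord_continuous. Qed.

Lemma continuous_sum (T : topologicalType) (I : Type) (r : seq I) (P : pred I)
    (f : I -> T -> R) :
  (forall i, continuous (f i)) -> continuous (fun t => \sum_(i <- r | P i) f i t).
Proof.
move=> cf; apply: (@continuous_big R^o); first exact: add_continuous.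
by move=> i _; exact: cf.
Qed.

Lemma continuous_mulmx n k (A : 'M[R]_(n, k)) :
  continuous (fun x : 'rV[R]_n => x *m A).
Proof.
apply: continuous_row => j.
under [X in continuous X]eq_fun do rewrite mxE.
apply: continuous_sum => i x; apply: continuousM; last exact: cst_continuous.
exact: continuous_coord.
Qed.

Definition positive_mass n (x : 'rV[R]_n.+1) : R := \sum_i Num.max (x 0 i) 0.

(** A retraction onto the simplex: negative coordinates are cut off, a total mass
    above 1 is scaled down, and the missing mass is put on the first vertex. *)
Definition to_simplex_row n (x : 'rV[R]_n.+1) : 'rV[R]_n.+1 :=
  \row_i (Num.max (x 0 i) 0 / Num.max 1 (positive_mass x) +
    (i == ord0)%:R * (1 - positive_mass x / Num.max 1 (positive_mass x))).

Lemma to_simplex_row_in n (x : 'rV[R]_n.+1) :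
  to_simplex_row x \in std_simplex R n.
Proof.
have d0 : 0 < Num.max 1 (positive_mass x) by rewrite lt_max ltr01.
apply/mem_set; split=> [i|].
  rewrite mxE; apply: addr_ge0.
    by rewrite divr_ge0 ?(ltW d0) // le_max lexx orbT.
  by rewrite mulr_ge0 ?ler0n // subr_ge0 ler_pdivrMr // mul1r le_max lexx orbT.
under eq_bigr do rewrite mxE.
rewrite big_split /= -mulr_suml -/(positive_mass x) -mulr_suml.
by rewrite (bigD1 ord0) //= big1 ?addr0 ?mul1r ?subrKC // => i /negbTE ->; rewrite ?mul0r.
Qed.

Definition to_simplex n (x : 'rV[R]_n.+1) : set_type (std_simplex R n) :=
  exist _ (to_simplex_row x) (to_simplex_row_in x).

Lemma to_simplex_id n (t : set_type (std_simplex R n)) :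
  to_simplex (set_val t) = t.
Proof.
apply/val_inj => /=; have [t0 t1] := set_mem (valP t).
have max_t i : Num.max (set_val t 0 i) 0 = set_val t 0 i by apply/max_idPl/t0.
apply/rowP => i; rewrite mxE max_t.
suff -> : positive_mass (set_val t) = 1.
  by rewrite maxxx !divr1 subrr mulr0 addr0.
by rewrite -[RHS]t1; apply: eq_bigr => j _; exact: max_t.
Qed.

Lemma val_to_simplex n (x : 'rV[R]_n.+1) :
  std_simplex R n x -> set_val (to_simplex x) = x.
Proof.
move=> /mem_set xS; pose t : set_type (std_simplex R n) := exist _ x xS.
by rewrite -[x]/(set_val t) to_simplex_id.
Qed.

Lemma to_simplex_continuous n : continuous (@to_simplex n).
Proof.
apply: continuous_comp_initial; apply: continuous_row => k.
have cpos i : continuous (fun x : 'rV[R]_n.+1 => Num.max (x 0 i) 0).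
  move=> x; apply: (@continuous_max R _ (fun x : 'rV[R]_n.+1 => x 0 i) (cst 0)).
    exact: continuous_coord.
  exact: cst_continuous.
have cmass : continuous (@positive_mass n) by exact: continuous_sum.
have cden : continuous (fun x => (Num.max 1 (@positive_mass n x))^-1).
  move=> x; apply: (continuousV (s := fun x => Num.max 1 (positive_mass x))).
    by rewrite gt_eqF // lt_max ltr01.
  apply: (@continuous_max R _ (cst 1) (@positive_mass n)); last exact: cmass.
  exact: cst_continuous.
rewrite (_ : (fun _ => _) = (fun x : 'rV[R]_n.+1 =>
    Num.max (x 0 k) 0 / Num.max 1 (positive_mass x) +
    (k == ord0)%:R * (1 - positive_mass x / Num.max 1 (positive_mass x)))).
  move=> x; apply: (for_continuousD (V := R^o)).
    by apply: for_continuousM; [exact: cpos|exact: cden].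
  apply: for_continuousM; first exact: for_continuous_cst.
  apply: (for_continuousB (V := R^o)); first exact: for_continuous_cst.
  by apply: for_continuousM; [exact: cmass|exact: cden].
by apply/funext => x; rewrite /= mxE.
Qed.

Context {M : topologicalType}.

Definition simplex_of n (f : 'rV[R]_n.+1 -> M) (cf : continuous f) :
    singular_simplex R M n :=
  mkcts (fun t => continuous_comp (@initial_continuous _ _ set_val t) (cf _)).

(** Precomposing with the retraction [to_simplex] makes a singular simplex a
    continuous map on the whole space, so that it composes with affine maps
    without membership proofs. *)
Definition extend n (s : singular_simplex R M n) (x : 'rV[R]_n.+1) : M :=
  s (to_simplex x).

Lemma extend_continuous n (s : singular_simplex R M n) : continuous (extend s).
Proof.
move=> x; apply: continuous_comp; first exact: to_simplex_continuous.
exact: cts_fun.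
Qed.

Lemma simplex_ofE n (f : 'rV[R]_n.+1 -> M) (cf : continuous f) t :
  simplex_of cf t = f (set_val t).
Proof. by []. Qed.

Lemma extend_val n (s : singular_simplex R M n) t : extend s (set_val t) = s t.
Proof. by rewrite /extend to_simplex_id. Qed.

Lemma simplex_eq n (s s' : singular_simplex R M n) :
  (forall t, s t = s' t) -> s = s'.
Proof. by move=> ss'; apply/continuousEP. Qed.

Lemma faceE n (i : 'I_n.+2) (s : singular_simplex R M n.+1) t :
  face i s t = extend s (face_row i (set_val t)).
Proof. by rewrite -[face_row _ _]/(set_val (face_map i t)) extend_val. Qed.

Lemma extend_ofE n (f : 'rV[R]_n.+1 -> M) (cf : continuous f) x :
  std_simplex R n x -> extend (simplex_of cf) x = f x.
Proof. by move=> xS; rewrite /extend simplex_ofE val_to_simplex. Qed.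

End Simplices.

(** * Singular chains and their subdivision *)

Section SingularChains.
Context {R : realType} {M : topologicalType} {K : comNzRingType}.
Implicit Types (A : set M) (n k : nat).
Local Notation chain := (chain R M K).

HB.instance Definition _ n := GRing.Linear.copy (@boundary R M K n)
  (fglift (fun s : singular_simplex R M n.+1 =>
    \sum_(i < n.+2) << (-1) ^+ i *g face i s >>)).

Lemma boundaryU n (s : singular_simplex R M n.+1) :
  boundary (<< s >> : chain n.+1) = \sum_(i < n.+2) (-1) ^+ i *: << face i s >>.
Proof.
by rewrite /boundary fgliftU; apply: eq_bigr => i _; rewrite freegUZ.
Qed.

Lemma chain_inE A n (c : chain n) :
  chain_in A c <-> supported (fun s : singular_simplex R M n => range s `<=` A) c.
Proof. by split=> h s; have := h s; rewrite mem_dom. Qed.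

Lemma chain_in0 A n : chain_in A (0 : chain n).
Proof. by apply/chain_inE; exact: supported0. Qed.

Lemma chain_inD A n (c d : chain n) :
  chain_in A c -> chain_in A d -> chain_in A (c + d).
Proof. by move=> /chain_inE ? /chain_inE ?; apply/chain_inE; exact: supportedD. Qed.

Lemma chain_inN A n (c : chain n) : chain_in A c -> chain_in A (- c).
Proof. by move=> /chain_inE ?; apply/chain_inE; exact: supportedN. Qed.

Lemma chain_inB A n (c d : chain n) :
  chain_in A c -> chain_in A d -> chain_in A (c - d).
Proof. by move=> ? ?; apply: chain_inD => //; exact: chain_inN. Qed.

Lemma chain_inZ A n a (c : chain n) : chain_in A c -> chain_in A (a *: c).
Proof. by move=> /chain_inE ?; apply/chain_inE; exact: supportedZ. Qed.

Lemma chain_inS A B n (c : chain n) : A `<=` B -> chain_in A c -> chain_in B c.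
Proof. by move=> AB cA s /cA sA; exact: subset_trans AB. Qed.

Lemma chain_inI A B n (c : chain n) :
  chain_in A c -> chain_in B c -> chain_in (A `&` B) c.
Proof. by move=> cA cB s sc; rewrite subsetI; split; [exact: cA|exact: cB]. Qed.

Lemma chain_inT n (c : chain n) : chain_in [set: M] c.
Proof. by []. Qed.

Lemma std_simplex_vertex n (i : 'I_n.+1) : std_simplex R n (delta_mx 0 i).
Proof.
split=> [j|]; first by rewrite mxE eqxx ler0n.
rewrite (bigD1 i) //= mxE !eqxx big1 ?addr0 // => j ji.
by rewrite mxE eqxx (negbTE ji).
Qed.

Lemma chain_in_set0 n (c : chain n) : chain_in set0 c -> c = 0.
Proof.
move=> /chain_inE c0; apply/eqP/freeg_eqP => s; rewrite coeff0; apply/eqP.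
by apply: contrapT => /negP/c0 /(_ (s (to_simplex 0))); apply; exists (to_simplex 0).
Qed.

Lemma extend_range n (s : singular_simplex R M n) x : range s (extend s x).
Proof. by exists (to_simplex x). Qed.

Lemma range_face n (i : 'I_n.+2) (s : singular_simplex R M n.+1) :
  range (face i s) `<=` range s.
Proof. by move=> _ [t _ <-]; rewrite faceE; exact: extend_range. Qed.

Lemma chain_in_boundary A n (c : chain n.+1) :
  chain_in A c -> chain_in A (boundary c).
Proof.
move=> /chain_inE cA; apply/chain_inE; apply: supported_lift cA => s sA.
apply: supported_sum => i _; rewrite freegUZ; apply: supportedZ.
by apply: supportedU; apply: subset_trans sA; exact: range_face.
Qed.

Lemma continuous_affine n (s : singular_simplex R M n) k
    (V : 'M[R]_(k.+1, n.+1)) :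
  continuous (fun x : 'rV[R]_k.+1 => extend s (x *m V)).
Proof.
move=> x; apply: (@continuous_comp _ _ _ (fun x : 'rV[R]_k.+1 => x *m V) (extend s)).
  exact: continuous_mulmx.
exact: extend_continuous.
Qed.

Definition affine_simplex n (s : singular_simplex R M n) k
    (V : 'M[R]_(k.+1, n.+1)) : singular_simplex R M k :=
  simplex_of (@continuous_affine n s k V).

Lemma affine_simplexE n (s : singular_simplex R M n) k
    (V : 'M[R]_(k.+1, n.+1)) t :
  affine_simplex s V t = extend s (set_val t *m V).
Proof. by []. Qed.

Definition realize n (s : singular_simplex R M n) {k} :
    affine_chain R K k.+1 n.+1 -> chain k :=
  fglift (fun V => << affine_simplex s V >>).

HB.instance Definition _ n s k := GRing.Linear.copy (@realize n s k)
  (fglift (fun V => << affine_simplex s V >>)).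

Lemma realizeU n (s : singular_simplex R M n) k (V : 'M[R]_(k.+1, n.+1)) :
  realize s << V >> = << affine_simplex s V >>.
Proof. exact: fgliftU. Qed.

Lemma face_row_mulmx k n (i : 'I_k.+2) (t : 'rV[R]_k.+1) (V : 'M[R]_(k.+2, n)) :
  face_row i t *m V = t *m (row' i V : 'M[R]_(k.+1, n)).
Proof.
apply/rowP => l; rewrite !mxE.
under eq_bigr do rewrite mxE mulr_suml.
rewrite (exchange_big_dep predT) //=; apply: eq_bigr => j _.
by rewrite (big_pred1 (fintype.lift i j)) ?mxE // => m; rewrite eq_sym.
Qed.

Lemma face_affine_simplex n (s : singular_simplex R M n) k
    (V : 'M[R]_(k.+2, n.+1)) (i : 'I_k.+2) :
  face i (affine_simplex s V) = affine_simplex s (row' i V : 'M[R]_(k.+1, _)).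
Proof.
apply: simplex_eq => t; rewrite faceE extend_ofE ?affine_simplexE.
  by rewrite face_row_mulmx.
by apply/set_mem; exact: face_row_simplex.
Qed.

Lemma boundary_realize n (s : singular_simplex R M n) k
    (c : affine_chain R K k.+2 n.+1) :
  boundary (realize s c) = realize s (affine_boundary c).
Proof.
move: c; refine (linear_freeg_eq (f := @boundary R M K k \o realize s)
  (g := realize s \o affine_boundary) _); move=> V /=.
rewrite realizeU boundaryU affine_boundaryU linear_sum; apply: eq_bigr => i _.
by rewrite linearZ /= realizeU face_affine_simplex.
Qed.

Lemma affine_simplex1 n (s : singular_simplex R M n) : affine_simplex s 1%:M = s.
Proof.
by apply: simplex_eq => t; rewrite affine_simplexE mulmx1 extend_val.
Qed.

Lemma realize1 n (s : singular_simplex R M n) : realize s << 1%:M >> = << s >>.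
Proof. by rewrite realizeU affine_simplex1. Qed.

Lemma std_simplex_mulmx k n (x : 'rV[R]_k.+1) (V : 'M[R]_(k.+1, n.+1)) :
  std_simplex R k x -> rows_in (std_simplex R n) V -> std_simplex R n (x *m V).
Proof.
move=> [x0 x1] SV; split=> [i|].
  rewrite mxE sumr_ge0 // => j _; rewrite mulr_ge0 //.
  by have [/(_ i)] := SV j; rewrite mxE.
under eq_bigr do rewrite mxE.
rewrite exchange_big /= -[RHS]x1; apply: eq_bigr => j _.
by rewrite -mulr_sumr; have [_] := SV j; under eq_bigr do rewrite mxE;
  move=> ->; rewrite mulr1.
Qed.

Lemma average_closed_std_simplex n : average_closed (std_simplex R n).
Proof.
move=> k V SV.
have -> : barycenter V = const_mx k.+1%:R^-1 *m V.
  apply/rowP => l; rewrite barycenterE mxE mulr_sumr.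
  by apply: eq_bigr => i _; rewrite mxE.
apply: std_simplex_mulmx => //; split=> [i|]; first by rewrite mxE invr_ge0 ler0n.
under eq_bigr do rewrite mxE.
by rewrite sumr_const card_ord -[_ *+ _]mulr_natl divff // pnatr_eq0.
Qed.

Lemma rows_in_std_simplex1 n : rows_in (std_simplex R n) (1%:M : 'M[R]_n.+1).
Proof. by move=> i; rewrite row1; exact: std_simplex_vertex. Qed.

Definition stochastic {n k} (V : 'M[R]_(k, n.+1)) := rows_in (std_simplex R n) V.

Lemma affine_simplex_comp n (s : singular_simplex R M n) k
    (V : 'M[R]_(k.+1, n.+1)) l (W : 'M[R]_(l.+1, k.+1)) :
  stochastic W -> affine_simplex (affine_simplex s V) W = affine_simplex s (W *m V).
Proof.
move=> SW; apply: simplex_eq => t; rewrite affine_simplexE extend_ofE.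
  by rewrite affine_simplexE mulmxA.
by apply: std_simplex_mulmx => //; exact: set_mem (valP t).
Qed.

Lemma realize_affine_simplex n (s : singular_simplex R M n) k
    (V : 'M[R]_(k.+1, n.+1)) l (c : affine_chain R K l.+1 k.+1) :
  supported stochastic c ->
  realize (affine_simplex s V) c = realize s (affine_map V c).
Proof.
refine (linear_freeg_eq_on (f := realize (affine_simplex s V))
  (g := realize s \o affine_map V) _); move=> W SW /=.
by rewrite affine_mapU !realizeU affine_simplex_comp.
Qed.

Definition subdivide n : chain n -> chain n :=
  fglift (fun s => realize s (subdivision << 1%:M >>)).

HB.instance Definition _ n := GRing.Linear.copy (@subdivide n)
  (fglift (fun s => realize s (subdivision << 1%:M >>))).

Definition subdivide_htpy n : chain n -> chain n.+1 :=
  fglift (fun s => realize s (subdivision_htpy << 1%:M >>)).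

HB.instance Definition _ n := GRing.Linear.copy (@subdivide_htpy n)
  (fglift (fun s => realize s (subdivision_htpy << 1%:M >>))).

Lemma supported_stochastic1 n :
  supported stochastic (<< 1%:M : 'M[R]_n.+1 >> : affine_chain R K n.+1 n.+1).
Proof. by apply: supportedU; exact: rows_in_std_simplex1. Qed.

(** Naturality: subdividing the image of an affine chain is taking the image of
    the subdivided affine chain. The identities below reduce to affine ones in
    this way, because every [s] is the image of the identity matrix. *)
Lemma subdivide_realize n (s : singular_simplex R M n) k
    (c : affine_chain R K k.+1 n.+1) :
  supported stochastic c -> subdivide (realize s c) = realize s (subdivision c).
Proof.
refine (linear_freeg_eq_on (f := @subdivide k \o realize s)
  (g := realize s \o subdivision) _); move=> V SV /=.
rewrite realizeU /subdivide fgliftU realize_affine_simplex.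
  by rewrite -subdivision_map affine_mapU mul1mx.
apply: supported_subdivision; first exact: average_closed_std_simplex.
exact: supported_stochastic1.
Qed.

Lemma subdivide_htpy_realize n (s : singular_simplex R M n) k
    (c : affine_chain R K k.+1 n.+1) :
  supported stochastic c ->
  subdivide_htpy (realize s c) = realize s (subdivision_htpy c).
Proof.
refine (linear_freeg_eq_on (f := @subdivide_htpy k \o realize s)
  (g := realize s \o subdivision_htpy) _); move=> V SV /=.
rewrite realizeU /subdivide_htpy fgliftU realize_affine_simplex.
  by rewrite -subdivision_htpy_map affine_mapU mul1mx.
apply: supported_subdivision_htpy; first exact: average_closed_std_simplex.
exact: supported_stochastic1.
Qed.

Lemma boundary_boundary n (c : chain n.+2) : boundary (boundary c) = 0.
Proof.
move: c; refine (linear_freeg_eq (f := @boundary R M K n \o @boundary R M K n.+1)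
  (g := \0) _); move=> s /=.
by rewrite -realize1 !boundary_realize affine_boundary_boundary linear0.
Qed.

Lemma subdivide_boundary n (c : chain n.+1) :
  boundary (subdivide c) = subdivide (boundary c).
Proof.
move: c; refine (linear_freeg_eq (f := @boundary R M K n \o @subdivide n.+1)
  (g := @subdivide n \o @boundary R M K n) _); move=> s /=.
have S1 := @supported_stochastic1 n.+1.
rewrite -realize1 subdivide_realize // !boundary_realize.
rewrite subdivide_realize; last exact: supported_affine_boundary.
by rewrite subdivision_boundary.
Qed.

Lemma subdivide_homotopy n (c : chain n.+1) :
  c - subdivide c = boundary (subdivide_htpy c) + subdivide_htpy (boundary c).
Proof.
move: c; refine (linear_freeg_eq (f := idfun \- @subdivide n.+1)
  (g := (@boundary R M K n.+1 \o @subdivide_htpy n.+1) \+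
        (@subdivide_htpy n \o @boundary R M K n)) _); move=> s /=.
have S1 := @supported_stochastic1 n.+1.
rewrite -realize1 subdivide_realize // subdivide_htpy_realize // !boundary_realize.
rewrite subdivide_htpy_realize; last exact: supported_affine_boundary.
by rewrite -linearD /= subdivision_homotopy linearB.
Qed.

Lemma subdivide_homotopy0 (c : chain 0) :
  c - subdivide c = boundary (subdivide_htpy c).
Proof.
move: c; refine (linear_freeg_eq (f := idfun \- @subdivide 0)
  (g := @boundary R M K 0 \o @subdivide_htpy 0) _); move=> s /=.
have S1 := @supported_stochastic1 0.
rewrite -realize1 subdivide_realize // subdivide_htpy_realize // boundary_realize.
have := subdivision_homotopy (<< 1%:M >> : affine_chain R K 1 1).
by rewrite addr0 => ->; rewrite linearB.
Qed.

Lemma chain_in_realize A n (s : singular_simplex R M n) k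
    (c : affine_chain R K k.+1 n.+1) :
  range s `<=` A -> chain_in A (realize s c).
Proof.
move=> sA; apply/chain_inE; apply: (@supported_lift _ _ _ (fun=> True)) => // V _.
by apply: supportedU => _ [t _ <-]; rewrite affine_simplexE; apply/sA/extend_range.
Qed.

Lemma chain_in_subdivide A n (c : chain n) :
  chain_in A c -> chain_in A (subdivide c).
Proof.
move=> /chain_inE cA; apply/chain_inE; apply: supported_lift cA => s sA.
by apply/chain_inE; exact: chain_in_realize.
Qed.

Lemma chain_in_subdivide_htpy A n (c : chain n) :
  chain_in A c -> chain_in A (subdivide_htpy c).
Proof.
move=> /chain_inE cA; apply/chain_inE; apply: supported_lift cA => s sA.
by apply/chain_inE; exact: chain_in_realize.
Qed.

End SingularChains.

(** * Small simplices *)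

(** Otherwise the sets [B] such that [A] minus [B] satisfies [P] would form a proper
    filter on [A] without cluster point. *)
Lemma compact_ind (T : topologicalType) (P : set T -> Prop) (A : set T) :
  P set0 -> (forall B C, P B -> P C -> P (B `|` C)) ->
  (forall B C, B `<=` C -> P C -> P B) ->
  compact A -> (forall x, A x -> exists2 B, nbhs x B & P B) -> P A.
Proof.
move=> P0 PU PS cA locP; apply: contrapT => nPA.
pose F : set_system T := [set B | P (A `\` B)].
have FF : ProperFilter F.
  split; first by rewrite /F/= setD0.
  split; first by rewrite /F/= setDT.
    by move=> B C PB PC; rewrite /F/= setDIr; exact: PU.
  by move=> B C BC; rewrite /F/=; apply: PS => x [Ax nCx]; split => // /BC.
have [|x [Ax clx]] := cA F FF; first by rewrite /F/= setDv.
have [B xB PB] := locP x Ax.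
have FB : F (~` B) by rewrite /F/= setDE setCK; apply: PS PB => y [].
by have [y []] := clx _ _ FB xB.
Qed.

Section SmallSimplices.
Context {R : realType}.

Lemma std_simplex_compact n : compact (std_simplex R n).
Proof.
pose f (x : 'rV[R]_n.+1) : 'rV[R]_n.+1 := set_val (to_simplex x).
have cf : continuous f.
  move=> x; apply: continuous_comp; first exact: to_simplex_continuous.
  exact: initial_continuous.
have cube := @rV_compact R n.+1 (fun=> `[0%R, 1%R]%classic)
  (fun=> @segment_compact R 0 1).
suff <- : f @` [set v : 'rV[R]_n.+1 | forall i, `[0%R, 1%R]%classic (v ord0 i)] =
    std_simplex R n.
  by apply: continuous_compact cube; exact: continuous_subspaceT.
apply/seteqP; split=> [_ [x _ <-]|x Sx]; first exact: set_mem (valP _).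
exists x; last exact: val_to_simplex.
case: Sx => x0 x1 i /=; rewrite in_itv /= x0 -x1 (bigD1 i) //=.
by rewrite lerDl sumr_ge0.
Qed.

Lemma nbhs_rowP n (x : 'rV[R]_n) (A : set 'rV[R]_n) : nbhs x A ->
  exists2 e : R, 0 < e &
    forall y : 'rV[R]_n, (forall l, `|x 0 l - y 0 l| < e) -> A y.
Proof.
move=> /nbhs_ballP[e /= e0 eA]; exists e => // y xy; apply: eA; split => // i j.
by rewrite ord1; exact: xy.
Qed.

Lemma nbhs_row_ball n (x : 'rV[R]_n) (e : R) : 0 < e ->
  nbhs x [set y : 'rV[R]_n | forall l, `|x 0 l - y 0 l| < e].
Proof.
move=> e0; apply/nbhs_ballP; exists e => //= y [_ xy] l; exact: xy.
Qed.

Context {M : topologicalType} {K : comNzRingType}.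
Implicit Types (W : set M).

(** Around a point of one of the preimages half the radius of a ball works; the
    minimum of two radii works for a union, so compactness applies. *)
Lemma lebesgue_number W1 W2 n (s : singular_simplex R M n) :
  open W1 -> open W2 -> range s `<=` W1 `|` W2 ->
  exists2 e : R, 0 < e & forall x, std_simplex R n x ->
    (forall y : 'rV[R]_n.+1, (forall l, `|x 0 l - y 0 l| < e) -> W1 (extend s y)) \/
    (forall y : 'rV[R]_n.+1, (forall l, `|x 0 l - y 0 l| < e) -> W2 (extend s y)).
Proof.
move=> oW1 oW2 sW.
pose near_in W (e : R) (x : 'rV[R]_n.+1) :=
  forall y : 'rV[R]_n.+1, (forall l, `|x 0 l - y 0 l| < e) -> W (extend s y).
have near_le W (e e' : R) x : e <= e' -> near_in W e' x -> near_in W e x.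
  by move=> ee' h y xy; apply: h => l; exact: lt_le_trans ee'.
pose P (B : set 'rV[R]_n.+1) := exists2 e : R, 0 < e &
  forall x, B x -> near_in W1 e x \/ near_in W2 e x.
apply: (@compact_ind _ P).
- by exists 1.
- move=> B C [e e0 eB] [d d0 dC]; exists (Num.min e d); first by rewrite lt_min e0.
  have mind : Num.min e d <= d by rewrite ge_min lexx orbT.
  have mine : Num.min e d <= e by rewrite ge_min lexx.
  by move=> x [/eB|/dC] [] h; [left|right|left|right]; apply: near_le h.
- by move=> B C BC [e e0 eC]; exists e => // x /BC/eC.
- exact: std_simplex_compact.
move=> x _.
have local W : open W -> W (extend s x) ->
    exists2 e : R, 0 < e &
    forall y : 'rV[R]_n.+1, (forall l, `|x 0 l - y 0 l| < e) -> near_in W e y.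
  move=> oW Wx; have : nbhs x (extend s @^-1` W).
    by apply: extend_continuous; exact: open_nbhs_nbhs.
  move=> /nbhs_rowP[e e0 eW]; exists (e / 2); first by rewrite divr_gt0.
  move=> y xy z yz; apply: eW => l; rewrite [e]splitr.
  apply: le_lt_trans (ltrD (xy l) (yz l)).
  exact: ler_distD.
have [Wx|Wx] := sW _ (extend_range s x).
  have [e e0 eW] := local _ oW1 Wx; eexists; first exact: (nbhs_row_ball x e0).
  by exists e => // y xy; left; exact: eW.
have [e e0 eW] := local _ oW2 Wx; eexists; first exact: (nbhs_row_ball x e0).
by exists e => // y xy; right; exact: eW.
Qed.

Local Notation chain := (chain R M K).

Definition small W1 W2 n (c : chain n) :=
  supported (fun s : singular_simplex R M n =>
    range s `<=` W1 \/ range s `<=` W2) c.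

Lemma small_subdivide W1 W2 n (c : chain n) :
  small W1 W2 c -> small W1 W2 (subdivide c).
Proof.
apply: supported_lift => s sW.
case: sW => sW; have /chain_inE :=
  chain_in_realize (K := K) (c := subdivision << 1%:M >>) sW.
  by apply: supported_sub => t; left.
by apply: supported_sub => t; right.
Qed.

Lemma iter_subdivide_small W1 W2 j n (c : chain n) :
  small W1 W2 c -> small W1 W2 (iter j (@subdivide R M K n) c).
Proof. by move=> cW; elim: j => //= j; exact: small_subdivide. Qed.

Lemma iter_subdivide_realize n (s : singular_simplex R M n) k
    (c : affine_chain R K k.+1 n.+1) j : supported stochastic c ->
  supported stochastic (iter j subdivision c) /\
  iter j (@subdivide R M K k) (realize s c) = realize s (iter j subdivision c).
Proof.
move=> Sc; elim: j => [//|j [Sj IHj]] /=; split; last first.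
  by rewrite IHj subdivide_realize.
by apply: supported_subdivision => //; exact: average_closed_std_simplex.
Qed.

Lemma exists_small_expr k (e : R) : 0 < e ->
  exists j, ((k%:R / k.+1%:R) ^+ j < e)%R.
Proof.
move=> e0; have q1 : `|k%:R / k.+1%:R : R| < 1.
  by rewrite ger0_norm ?divr_ge0 ?ler0n // ltr_pdivrMr ?ltr0n // mul1r ltr_nat.
have /cvgrPdist_lt /(_ _ e0) [j _ /(_ j (leqnn _))] := cvg_expr q1.
rewrite /= sub0r normrN ger0_norm ?exprn_ge0 ?divr_ge0 ?ler0n //.
by exists j.
Qed.

(** In the iterated subdivision of the standard simplex every simplex is smaller
    than a Lebesgue number of the cover pulled back by [s]. *)
Lemma simplex_small W1 W2 n (s : singular_simplex R M n) :
  open W1 -> open W2 -> range s `<=` W1 `|` W2 ->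
  exists j, small W1 W2 (iter j (@subdivide R M K n) << s >>).
Proof.
move=> oW1 oW2 sW; have [e e0 eW] := lebesgue_number oW1 oW2 sW.
have [j je] := exists_small_expr n e0; exists j.
rewrite -realize1.
have [Sj ->] := iter_subdivide_realize s j (@supported_stochastic1 R K n).
have osc l := @iter_subdivision_oscillation R K _ n l 1 (1%:M : 'M[R]_n.+1) j.
apply: (@supported_lift _ _ _ (fun V : 'M[R]_(n.+1, n.+1) => stochastic V /\
    forall l, oscillation_le l ((n%:R / n.+1%:R) ^+ j) V)); last first.
  move=> V cV; split; first exact: Sj.
  move=> l; have := osc l; rewrite mulr1 => /(_ _ _ cV); apply.
  move=> a b; rewrite !mxE; case: (a == l) (b == l) => [] [];
    by rewrite /= ?subrr ?normr0 ?subr0 ?sub0r ?normrN ?normr1 ?ler01.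
move=> V [SV oscV]; apply: supportedU.
have close (t : 'rV[R]_n.+1) : std_simplex R n t ->
    forall l, `|row ord0 V 0 l - (t *m V) 0 l| < e.
  move=> [t0 t1] l; apply: le_lt_trans je.
  have -> : row ord0 V 0 l - (t *m V) 0 l =
      \sum_i t 0 i * (V ord0 l - V i l).
    by under [RHS]eq_bigr do rewrite mulrBr; rewrite sumrB -mulr_suml t1 mul1r !mxE.
  apply: (le_trans (ler_norm_sum _ _ _)).
  rewrite -[leRHS]mul1r -[X in _ <= X * _]t1 mulr_suml; apply: ler_sum => i _.
  by rewrite (@normrM R) (ger0_norm (t0 i)) ler_wpM2l //; exact: oscV.
have [h|h] := eW _ (SV ord0); [left|right] => _ [t _ <-];
  by rewrite affine_simplexE; apply/h/close; exact: set_mem (valP t).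
Qed.

Lemma chain_small W1 W2 n (c : chain n) :
  open W1 -> open W2 -> chain_in (W1 `|` W2) c ->
  exists j, small W1 W2 (iter j (@subdivide R M K n) c).
Proof.
move=> oW1 oW2 /chain_inE; move: c; apply: supported_ind.
- by exists 0; exact: supported0.
- move=> c d [i ic] [j jd]; exists (i + j)%N.
  have iter_add m : iter m (@subdivide R M K n) (c + d) =
      iter m (@subdivide R M K n) c + iter m (@subdivide R M K n) d.
    by elim: m => //= m ->; rewrite linearD.
  rewrite iter_add; apply: supportedD; last by rewrite iterD; exact: iter_subdivide_small.
  by rewrite addnC iterD; exact: iter_subdivide_small.
- move=> a c [j jc]; exists j.
  have -> : iter j (@subdivide R M K n) (a *: c) = a *: iter j (@subdivide R M K n) c.
    by elim: j {jc} => //= j ->; rewrite linearZ.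
  exact: supportedZ.
- by move=> s sW; exact: simplex_small.
Qed.

(** [deformation_err] stands for the term T (boundary c) of the homotopy formula
    c - S c = boundary (T c) + T (boundary c); it is a separate field because in
    degree zero there is no boundary to apply T to. *)
Record deformation := Deformation {
  deform : forall n, chain n -> chain n;
  deformation_htpy : forall n, chain n -> chain n.+1;
  deformation_err : forall n, chain n -> chain n;
  deformD : forall n (c d : chain n), deform (c + d) = deform c + deform d;
  deform_boundary : forall n (c : chain n.+1),
    boundary (deform c) = deform (boundary c);
  deformationE : forall n (c : chain n),
    c = deform c + boundary (deformation_htpy c) + deformation_err c;
  deform_in : forall A n (c : chain n), chain_in A c -> chain_in A (deform c);
  deformation_htpy_in : forall A n (c : chain n),
    chain_in A c -> chain_in A (deformation_htpy c);
  deformation_err_in : forall A n (c : chain n),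
    is_relative_cycle A c -> chain_in A (deformation_err c)
}.

Lemma deform_relative_cycle (D : deformation) A n (c : chain n) :
  is_relative_cycle A c -> is_relative_cycle A (deform D c).
Proof.
by case: n c => //= n c cA; rewrite deform_boundary; exact: deform_in.
Qed.

Definition trivial_deformation : deformation.
Proof.
apply: (@Deformation (fun n => id) (fun n => cst 0) (fun n => cst 0)) => //.
- by move=> n c; rewrite /cst /= linear0 !addr0.
- by move=> *; exact: chain_in0.
- by move=> *; exact: chain_in0.
Defined.

Definition subdivide_after (D : deformation) : deformation.
Proof.
pose err n : chain n -> chain n :=
  match n with 0 => cst 0 | n'.+1 => fun c => subdivide_htpy (boundary c) end.
apply: (@Deformation (fun n c => subdivide (deform D c))
  (fun n c => deformation_htpy D c + subdivide_htpy (deform D c))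
  (fun n c => deformation_err D c + err n (deform D c))).
- by move=> n c d; rewrite deformD linearD.
- by move=> n c; rewrite subdivide_boundary deform_boundary.
- move=> n c; rewrite linearD [RHS](AC (1*2*2) (1*3*5*2*4)) /=.
  rewrite {1}[c](deformationE D); congr (_ + _ + _); apply/eqP.
  rewrite -addrA addrC -subr_eq; apply/eqP.
  case: n c @err => [|n] c err /=; first by rewrite addr0 subdivide_homotopy0.
  by rewrite subdivide_homotopy.
- by move=> A n c /deform_in ?; exact: chain_in_subdivide.
- move=> A n c cA; apply: chain_inD; first exact: deformation_htpy_in.
  by apply: chain_in_subdivide_htpy; exact: deform_in.
- move=> A n c cA; apply: chain_inD; first exact: deformation_err_in.
  have := deform_relative_cycle D cA; case: n c @err {cA} => [|n] c err /=.
    by move=> _; exact: chain_in0.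
  exact: chain_in_subdivide_htpy.
Defined.

Lemma small_deformation W1 W2 n (c : chain n) :
  open W1 -> open W2 -> chain_in (W1 `|` W2) c ->
  exists (D : deformation) (c1 c2 : chain n),
    [/\ deform D c = c1 + c2, chain_in W1 c1 & chain_in W2 c2].
Proof.
move=> oW1 oW2 cW; have [j] := chain_small oW1 oW2 cW.
have -> : iter j (@subdivide R M K n) c =
    deform (iter j subdivide_after trivial_deformation) c.
  by elim: j => //= j ->.
move=> /supported_split[c1 [c2 [c12 /chain_inE c1W /chain_inE c2W]]].
by exists (iter j subdivide_after trivial_deformation), c1, c2.
Qed.

End SmallSimplices.

(** * Relative Mayer-Vietoris *)

Section MayerVietoris.
Context {R : realType} {M : topologicalType} {K : comNzRingType}.
Implicit Types (U W : set M) (n : nat).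
Local Notation chain := (chain R M K).

(** The vanishing of H_n(W, U), for [U] included in [W]. *)
Definition acyclic_at n W U := forall c : chain n,
  chain_in W c -> is_relative_cycle U c ->
  exists2 b : chain n.+1, chain_in W b & chain_in U (c - boundary b).

Lemma acyclic_at_refl n U : acyclic_at n U U.
Proof.
by move=> c cU _; exists 0; [exact: chain_in0|rewrite linear0 subr0].
Qed.

Lemma is_relative_cycleS U W n (c : chain n) :
  U `<=` W -> is_relative_cycle U c -> is_relative_cycle W c.
Proof. by case: n c => //= n c; exact: chain_inS. Qed.

Lemma cycle_relative_cycle U n (c : chain n) : is_cycle c -> is_relative_cycle U c.
Proof. by case: n c => //= n c ->; exact: chain_in0. Qed.

Lemma is_cycleB n (c d : chain n) : is_cycle c -> is_cycle d -> is_cycle (c - d).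
Proof. by case: n c d => //= n c d c0 d0; rewrite linearB /= c0 d0 subr0. Qed.

Lemma is_cycleZ n a (c : chain n) : is_cycle c -> is_cycle (a *: c).
Proof. by case: n c => //= n c c0; rewrite linearZ /= c0 scaler0. Qed.

Lemma chain_in_relative_cycle U n (c : chain n) :
  chain_in U c -> is_relative_cycle U c.
Proof. by case: n c => //= n c; exact: chain_in_boundary. Qed.

Lemma boundary_relative_cycle U n (c : chain n.+1) :
  is_relative_cycle U (boundary c).
Proof. by case: n c => //= n c; rewrite boundary_boundary; exact: chain_in0. Qed.

Lemma relative_cycleD U n (c d : chain n) :
  is_relative_cycle U c -> is_relative_cycle U d -> is_relative_cycle U (c + d).
Proof. by case: n c d => //= n c d; rewrite linearD; exact: chain_inD. Qed.

Lemma relative_cycleN U n (c : chain n) :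
  is_relative_cycle U c -> is_relative_cycle U (- c).
Proof. by case: n c => //= n c; rewrite linearN; exact: chain_inN. Qed.

Lemma relative_cycleB U n (c d : chain n) :
  is_relative_cycle U c -> is_relative_cycle U d -> is_relative_cycle U (c - d).
Proof. by move=> cU dU; apply: relative_cycleD => //; exact: relative_cycleN. Qed.

Lemma relative_cycleI U W n (c : chain n) :
  is_relative_cycle U c -> is_relative_cycle W c -> is_relative_cycle (U `&` W) c.
Proof. by case: n c => //= n c; exact: chain_inI. Qed.

Lemma acyclic_at_deform (D : deformation (R := R) (M := M) (K := K)) n W U
    (c : chain n) : chain_in W c -> is_relative_cycle U c ->
  (exists2 b, chain_in W b & chain_in U (deform D c - boundary b)) ->
  exists2 b, chain_in W b & chain_in U (c - boundary b).
Proof.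
move=> cW cU [b bW bU]; exists (b + deformation_htpy D c).
  by apply: chain_inD => //; exact: deformation_htpy_in.
rewrite {1}[c](deformationE D) linearD /=.
have -> : deform D c + boundary (deformation_htpy D c) + deformation_err D c -
    (boundary b + boundary (deformation_htpy D c)) =
    (deform D c - boundary b) + deformation_err D c.
  by rewrite opprD (AC (3*2) (1*4*3*(2*5))) /= subrr addr0.
by apply: chain_inD => //; exact: deformation_err_in.
Qed.

(** H_n of the pair of unions lies between the sum of H_n(W1, U1) and H_n(W2, U2)
    and H_(n-1) of the pair of intersections in an exact sequence. On chains: a
    cycle is made small with respect to [W1] and [W2], then its boundary with
    respect to [U1] and [U2]. *)
Lemma mayer_vietoris n W1 W2 U1 U2 :
  open W1 -> open W2 -> open U1 -> open U2 -> U1 `<=` W1 -> U2 `<=` W2 ->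
  acyclic_at n W1 U1 -> acyclic_at n W2 U2 ->
  (if n is m.+1 then acyclic_at m (W1 `&` W2) (U1 `&` U2) else True) ->
  acyclic_at n (W1 `|` W2) (U1 `|` U2).
Proof.
move=> oW1 oW2 oU1 oU2 UW1 UW2 ac1 ac2 ac12 c cW cU.
have [D [c1 [c2 [Dc c1W c2W]]]] := small_deformation oW1 oW2 cW.
apply: (acyclic_at_deform (D := D)) => //.
have := deform_relative_cycle D cU; rewrite {}Dc => {c cW cU}.
have W1U : W1 `<=` W1 `|` W2 by move=> x; left.
have W2U : W2 `<=` W1 `|` W2 by move=> x; right.
have U1U : U1 `<=` U1 `|` U2 by move=> x; left.
have U2U : U2 `<=` U1 `|` U2 by move=> x; right.
have merge (e1 e2 : chain n) :
    (exists2 b, chain_in W1 b & chain_in U1 (e1 - boundary b)) ->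
    (exists2 b, chain_in W2 b & chain_in U2 (e2 - boundary b)) ->
    exists2 b, chain_in (W1 `|` W2) b & chain_in (U1 `|` U2) (e1 + e2 - boundary b).
  move=> [b1 b1W e1U] [b2 b2W e2U]; exists (b1 + b2).
    by apply: chain_inD; [exact: chain_inS b1W|exact: chain_inS b2W].
  rewrite linearD /= opprD addrACA.
  by apply: chain_inD; [exact: chain_inS e1U|exact: chain_inS e2U].
case: n ac1 ac2 ac12 merge c1 c2 c1W c2W => [|n] ac1 ac2 ac12 merge c1 c2 c1W c2W cU.
  by apply: merge; [exact: ac1|exact: ac2].
have c12W : chain_in (W1 `|` W2) (c1 + c2).
  by apply: chain_inD; [exact: chain_inS c1W|exact: chain_inS c2W].
have [D' [u1 [u2 [Du u1U u2U]]]] := small_deformation oU1 oU2 cU.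
apply: (acyclic_at_deform (D := D')) => //.
rewrite deformD; set e1 := deform D' c1; set e2 := deform D' c2.
have e1W : chain_in W1 e1 by exact: deform_in.
have e2W : chain_in W2 e2 by exact: deform_in.
have e12 : boundary e1 + boundary e2 = u1 + u2.
  by rewrite -linearD /= -deformD deform_boundary.
(* The parts e1 and e2 are relative cycles up to a chain w in the intersection. *)
pose w := boundary e1 - u1.
have wE : w = u2 - boundary e2.
  by apply/eqP; rewrite subr_eq addrAC [u2 + u1]addrC -e12 addrK.
have wW : chain_in (W1 `&` W2) w.
  apply: chain_inI; last rewrite wE.
    by apply: chain_inB; [exact: chain_in_boundary|exact: chain_inS u1U].
  by apply: chain_inB; [exact: chain_inS u2U|exact: chain_in_boundary].
have wU : is_relative_cycle (U1 `&` U2) w.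
  apply: relative_cycleI; last rewrite wE.
    apply: relative_cycleB; first exact: boundary_relative_cycle.
    exact: chain_in_relative_cycle.
  apply: relative_cycleB; first exact: chain_in_relative_cycle.
  exact: boundary_relative_cycle.
have [b bW bU] := ac12 _ wW wU.
have -> : e1 + e2 = (e1 - b) + (e2 + b) by rewrite addrACA addNr addr0.
apply: merge; [apply: ac1|apply: ac2].
- by apply: chain_inB => //; apply: chain_inS bW => x [].
- have -> : is_relative_cycle U1 (e1 - b) = chain_in U1 (boundary (e1 - b)) by [].
  have -> : boundary (e1 - b) = u1 + (w - boundary b).
    by rewrite linearB addrA [u1 + w]addrC subrK.
  by apply: chain_inD => //; apply: chain_inS bU => x [].
- by apply: chain_inD => //; apply: chain_inS bW => x [].
- have -> : is_relative_cycle U2 (e2 + b) = chain_in U2 (boundary (e2 + b)) by [].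
  have -> : boundary (e2 + b) = u2 - (w - boundary b).
    by rewrite linearD opprB wE opprB addrCA addrCA [boundary b + _]addrC addrA subrKC.
  by apply: chain_inB => //; apply: chain_inS bU => x [].
Qed.

(** This is [mayer_vietoris] for the pairs ([U], [U]) and ([W], [U `&` W]), whose
    intersection is a pair of equal sets. *)
Lemma excision n W U : open W -> open U ->
  acyclic_at n W (U `&` W) -> acyclic_at n (U `|` W) U.
Proof.
move=> oW oU acW.
have -> : acyclic_at n (U `|` W) U = acyclic_at n (U `|` W) (U `|` (U `&` W)).
  by congr acyclic_at; apply/seteqP; split=> x; [left|case=> [|[]]].
apply: (mayer_vietoris oU oW oU (openI oU oW)) => //.
  exact: acyclic_at_refl.
case: n {acW} => // n; rewrite setIA setIid; exact: acyclic_at_refl.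
Qed.

(** If the classes of [c] modulo [U1] and modulo [U2] vanish, the difference of the
    bounding chains is a cycle of one degree more modulo the union; writing it,
    up to a boundary, as a sum of chains in [U1] and in [U2] corrects them. *)
Lemma bounds_mod_setI n U1 U2 (c : chain n) :
  open U1 -> open U2 -> acyclic_at n.+1 setT (U1 `|` U2) ->
  is_relative_cycle (U1 `&` U2) c ->
  (exists b, chain_in U1 (c - boundary b)) ->
  (exists b, chain_in U2 (c - boundary b)) ->
  exists b, chain_in (U1 `&` U2) (c - boundary b).
Proof.
move=> oU1 oU2 ac cU [b1]; set u1 := c - _ => u1U [b2]; set u2 := c - _ => u2U.
have U1U : U1 `<=` U1 `|` U2 by move=> x; left.
have U2U : U2 `<=` U1 `|` U2 by move=> x; right.
have b12 : boundary (b1 - b2) = u2 - u1.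
  by rewrite linearB /u1 /u2 /= opprB [RHS]addrC addrA subrK.
have [|d _ dU] := ac (b1 - b2) (@chain_inT _ _ _ _ _).
  by rewrite /= b12; apply: chain_inB; [exact: chain_inS u2U|exact: chain_inS u1U].
have [D [w1 [w2 [Dw w1U w2U]]]] := small_deformation oU1 oU2 dU.
have w12 : boundary w1 + deform D u1 = deform D u2 - boundary w2.
  apply/eqP; rewrite eq_sym subr_eq addrAC -linearD -Dw /= deform_boundary.
  by rewrite linearB /= boundary_boundary subr0 b12 -deformD subrK.
exists (b1 + deformation_htpy D u1 - w1).
have -> : c - boundary (b1 + deformation_htpy D u1 - w1) =
    (boundary w1 + deform D u1) + deformation_err D u1.
  have -> : boundary (b1 + deformation_htpy D u1 - w1) =
      boundary b1 + boundary (deformation_htpy D u1) - boundary w1.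
    by rewrite linearB linearD.
  rewrite opprB addrCA -[RHS]addrA; congr (_ + _); rewrite opprD addrA -/u1.
  by apply/eqP; rewrite subr_eq addrAC -deformationE.
apply: chain_inD; last first.
  apply: deformation_err_in; apply: relative_cycleB => //.
  exact: boundary_relative_cycle.
apply: chain_inI; last rewrite w12.
  by apply: chain_inD; [exact: chain_in_boundary|exact: deform_in].
by apply: chain_inB; [exact: deform_in|exact: chain_in_boundary].
Qed.

Lemma acyclic_at_setI n U1 U2 : open U1 -> open U2 ->
  acyclic_at n setT U1 -> acyclic_at n setT U2 ->
  acyclic_at n.+1 setT (U1 `|` U2) -> acyclic_at n setT (U1 `&` U2).
Proof.
move=> oU1 oU2 ac1 ac2 ac12 c _ cU.
have [||b bU] := @bounds_mod_setI n U1 U2 c oU1 oU2 ac12 cU.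
- have [|b _ bU] := ac1 c (@chain_inT _ _ _ _ _); last by exists b.
  by apply: is_relative_cycleS cU => x [].
- have [|b _ bU] := ac2 c (@chain_inT _ _ _ _ _); last by exists b.
  by apply: is_relative_cycleS cU => x [].
by exists b.
Qed.

End MayerVietoris.

(** * Cones in Euclidean space *)

Section SingularCone.
Context {R : realType} {K : comNzRingType} {N : nat}.
Local Notation E := ('rV[R]_N).
Local Notation chain := (chain R E K).
Local Notation simplex := (singular_simplex R E).
Implicit Types (v : E) (n k : nat).

Lemma simplex_bounded n (s : simplex n) l :
  exists B : R, forall x, `|(extend s x) 0 l| <= B.
Proof.
have cpt : compact (extend s @` std_simplex R n).
  apply: continuous_compact; last exact: std_simplex_compact.
  by apply: continuous_subspaceT; exact: extend_continuous.
have [B [_ bB]] := compact_bounded cpt; exists (B + 1) => x.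
have inS : (extend s @` std_simplex R n) (extend s x).
  exists (set_val (to_simplex x)); last by rewrite extend_val.
  exact: set_mem (valP _).
have := bB (B + 1) _ _ inS; rewrite ltrDl ltr01 => /(_ isT).
apply: le_trans; rewrite [leRHS]/Num.Def.normr /= mx_normrE.
by apply/bigmax_geP; right => /=; exists (0, l).
Qed.

(** The continuity of a cone at its apex, where the base point is undefined but
    has a vanishing coefficient. *)
Lemma continuous_at0_bounded (T : topologicalType) (h g : T -> R) x B :
  continuous_at x h -> h x = 0 -> (forall t, `|g t| <= B) ->
  continuous_at x (fun t => h t * g t).
Proof.
move=> ch hx gB; have B0 : 0 <= B by exact: le_trans (gB x).
have B1 : 0 < B + 1 by rewrite ltr_wpDl.
apply/cvgrPdist_lt => e e0; rewrite hx mul0r.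
have /cvgrPdist_lt /(_ (e / (B + 1)) (divr_gt0 e0 B1)) := ch.
apply: filterS => t; rewrite hx !sub0r !normrN normrM ltr_pdivlMr // => ht.
apply: le_lt_trans ht; apply: ler_wpM2l => //.
by rewrite (le_trans (gB t)) // lerDl.
Qed.

(** The point of the opposite face on the ray from the apex through [t]. *)
Definition opposite_face n (t : 'rV[R]_n.+2) : 'rV[R]_n.+1 :=
  (1 - t 0 0)^-1 *: \row_j t 0 (fintype.lift ord0 j).

Definition cone_fun v n (s : simplex n) (t : 'rV[R]_n.+2) : E :=
  v + (1 - t 0 0) *: (extend s (opposite_face t) - v).

Lemma cone_fun_continuous v n (s : simplex n) : continuous (cone_fun v s).
Proof.
move=> x; have c1 : continuous_at x (fun t : 'rV[R]_n.+2 => 1 - t 0 0).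
  apply: (for_continuousB (V := R^o)); first exact: for_continuous_cst.
  exact: continuous_coord.
apply: continuous_at_row => l.
rewrite (_ : (fun _ => _) = (fun t : 'rV[R]_n.+2 =>
    v 0 l + (1 - t 0 0) * (extend s (opposite_face t) 0 l - v 0 l))); last first.
  by apply/funext => t; rewrite !mxE.
apply: (for_continuousD (V := R^o)); first exact: for_continuous_cst.
have [x1|x1] := eqVneq (1 - x 0 0) 0.
  have [B sB] := simplex_bounded s l.
  apply: (@continuous_at0_bounded _ _ _ _ (B + `|v 0 l|)) => // t.
  by rewrite (le_trans (ler_normB _ _)) // lerD2r.
apply: for_continuousM => //; apply: (for_continuousB (V := R^o)).
  apply: (@continuous_comp _ _ _ (fun t => extend s (opposite_face t))
    (fun y : E => y 0 l)); last exact: continuous_coord.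
  apply: continuous_comp; last exact: extend_continuous.
  apply: continuous_at_row => j.
  rewrite (_ : (fun _ => _) = (fun t : 'rV[R]_n.+2 =>
    (1 - t 0 0)^-1 * t 0 (fintype.lift ord0 j))); last first.
    by apply/funext => t; rewrite !mxE.
  apply: for_continuousM; last exact: continuous_coord.
  by apply: (continuousV (s := fun t : 'rV[R]_n.+2 => 1 - t 0 0)).
exact: for_continuous_cst.
Qed.

Definition cone v n (s : simplex n) : simplex n.+1 :=
  simplex_of (@cone_fun_continuous v n s).

Definition point v : simplex 0 := simplex_of (@cst_continuous 'rV[R]_1 E v).

Lemma face0_cone v n (s : simplex n) : face ord0 (cone v s) = s.
Proof.
apply: simplex_eq => t; rewrite faceE extend_ofE; last first.
  by apply/set_mem; exact: face_row_simplex.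
rewrite /cone_fun; set y := face_row _ _.
have y0 : y 0 0 = 0 by rewrite mxE big_pred0.
rewrite y0 subr0 scale1r subrKC -[RHS]extend_val; congr (extend s _).
rewrite /opposite_face y0 subr0 invr1 scale1r; apply/rowP => j; rewrite !mxE.
by rewrite (big_pred1 j) // => m; rewrite (inj_eq lift_inj).
Qed.

Lemma face_row_lift0 n (i : 'I_n.+2) (t : 'rV[R]_n.+2) :
  face_row (fintype.lift ord0 i) t 0 0 = t 0 0.
Proof.
rewrite mxE (big_pred1 ord0) // => m.
rewrite /= -[m == ord0]val_eqE -val_eqE /= /bump.
by case: (nat_of_ord m) => //= m'; lia.
Qed.

Lemma opposite_face_lift0 n (i : 'I_n.+2) (t : 'rV[R]_n.+2) :
  opposite_face (face_row (fintype.lift ord0 i) t) = face_row i (opposite_face t).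
Proof.
rewrite /opposite_face face_row_lift0; apply/rowP => j; rewrite !mxE.
under [RHS]eq_bigr do rewrite !mxE.
rewrite -mulr_sumr; congr (_ * _).
rewrite big_mkcond big_ord_recl /= add0r [RHS]big_mkcond /=.
have lift_lift (m : 'I_n.+1) :
    (fintype.lift (fintype.lift ord0 i) (fintype.lift ord0 m) ==
    fintype.lift ord0 j) = (fintype.lift i m == j).
  by rewrite -!val_eqE /= /bump /=; lia.
by apply: eq_bigr => m _; rewrite lift_lift.
Qed.

Lemma simplex_opposite_face n (t : 'rV[R]_n.+2) :
  std_simplex R n.+1 t -> 1 - t 0 0 != 0 -> std_simplex R n (opposite_face t).
Proof.
move=> [t0 t1] tn0.
have sumE : \sum_(j < n.+1) t 0 (fintype.lift ord0 j) = 1 - t 0 0.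
  by apply/eqP; rewrite eq_sym subr_eq -t1 big_ord_recl addrC.
split=> [j|].
  rewrite !mxE mulr_ge0 // invr_ge0 -sumE sumr_ge0 //.
under eq_bigr do rewrite !mxE.
by rewrite -mulr_sumr sumE mulVf.
Qed.

Lemma faceS_cone v n (i : 'I_n.+2) (s : simplex n.+1) :
  face (fintype.lift ord0 i) (cone v s) = cone v (face i s).
Proof.
apply: simplex_eq => t; rewrite faceE extend_ofE; last first.
  by apply/set_mem; exact: face_row_simplex.
rewrite simplex_ofE /cone_fun face_row_lift0 opposite_face_lift0.
have [->|t1] := eqVneq (1 - set_val t 0 0) 0; first by rewrite !scale0r.
congr (_ + _ *: (_ - _)).
set y := opposite_face _.
have Sy : std_simplex R n y.
  by apply: simplex_opposite_face => //; exact: set_mem (valP t).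
by rewrite /extend [in RHS]faceE val_to_simplex.
Qed.

Lemma face_cone0 v (s : simplex 0) :
  face (fintype.lift ord0 ord0) (cone v s) = point v.
Proof.
apply: simplex_eq => t; rewrite faceE extend_ofE; last first.
  by apply/set_mem; exact: face_row_simplex.
rewrite simplex_ofE /cone_fun.
have -> : face_row (fintype.lift ord0 ord0) (set_val t) 0 0 = 1.
  have [_ t1] := set_mem (valP t).
  rewrite -[RHS]t1 mxE big_mkcond /= !big_ord1.
  by [].
by rewrite subrr scale0r addr0.
Qed.

Definition cone_chain v n : chain n -> chain n.+1 :=
  fglift (fun s => << cone v s >>).

HB.instance Definition _ v n := GRing.Linear.copy (@cone_chain v n)
  (fglift (fun s => << cone v s >>)).

Lemma boundary_cone_chain v n (c : chain n.+1) :
  boundary (cone_chain v c) = c - cone_chain v (boundary c).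
Proof.
move: c; refine (linear_freeg_eq (f := @boundary R _ K _ \o @cone_chain v _)
  (g := idfun \- (@cone_chain v _ \o @boundary R _ K _)) _); move=> s /=.
rewrite /cone_chain fgliftU boundaryU big_ord_recl expr0 scale1r face0_cone.
congr (_ + _); rewrite boundaryU linear_sum -sumrN; apply: eq_bigr => i _.
by rewrite linearZ /= fgliftU faceS_cone exprS mulN1r scaleNr.
Qed.

Lemma boundary_cone_chain0 v (c : chain 0) :
  boundary (cone_chain v c) = c - fglift (fun=> << point v >>) c.
Proof.
move: c; refine (linear_freeg_eq (f := @boundary R _ K _ \o @cone_chain v _)
  (g := idfun \- fglift (fun=> << point v >>)) _); move=> s /=.
rewrite /cone_chain !fgliftU boundaryU big_ord_recl expr0 scale1r face0_cone.
by rewrite big_ord1 face_cone0 expr1 scaleN1r.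
Qed.

Definition star_shaped v (A : set E) :=
  forall y (a : R), A y -> 0 <= a <= 1 -> A (v + a *: (y - v)).

Lemma chain_in_cone v A n (c : chain n) :
  star_shaped v A -> chain_in A c -> chain_in A (cone_chain v c).
Proof.
move=> vA /chain_inE cA; apply/chain_inE; apply: supported_lift cA => s sA.
apply: supportedU => _ [t _ <-]; have [t0 t1] := set_mem (valP t).
apply: vA; first by apply: sA; exact: extend_range.
rewrite subr_ge0 lerBlDr lerDl t0 andbT -t1 (bigD1 0) //= lerDl.
by rewrite sumr_ge0.
Qed.

(** The cone from a point of [U] contracts both sets. *)
Lemma acyclic_star_shaped v n (W U : set E) :
  star_shaped v W -> star_shaped v U -> U v ->
  acyclic_at (R := R) (K := K) n W U.
Proof.
move=> vW vU Uv c cW cU; exists (cone_chain v c); first exact: chain_in_cone.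
case: n c cW cU => [|n] c cW cU.
  rewrite boundary_cone_chain0 subKr; apply/chain_inE.
  apply: (@supported_lift _ _ _ (fun=> True)) => // s _.
  by apply: supportedU => _ [t _ <-].
by rewrite boundary_cone_chain subKr; exact: chain_in_cone.
Qed.

Lemma acyclic_star_shaped_set0 v n (W : set E) :
  star_shaped v W -> acyclic_at (R := R) (K := K) n.+1 W set0.
Proof.
move=> vW c cW /chain_in_set0 c0; exists (cone_chain v c).
  exact: chain_in_cone.
by rewrite boundary_cone_chain subKr c0 linear0; exact: chain_in0.
Qed.

End SingularCone.

(** * Complements of polyhedra *)

Section ConvexCovers.
Context {R : realType} {K : comNzRingType} {N : nat}.
Local Notation E := ('rV[R]_N).
Local Notation acyclic_at := (@acyclic_at R E K).

Definition convex_subset (A : set E) :=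
  forall x y (a : R), A x -> A y -> 0 <= a <= 1 -> A (x + a *: (y - x)).

Lemma convex_subset_star A v : convex_subset A -> A v -> star_shaped v A.
Proof. by move=> cA Av y a Ay; exact: cA. Qed.

Lemma convex_subsetI A B :
  convex_subset A -> convex_subset B -> convex_subset (A `&` B).
Proof. by move=> cA cB x y a [Ax Bx] [Ay By] a01; split; [exact: cA|exact: cB]. Qed.

Definition union_of (I : eqType) (s : seq I) (U : I -> set E) : set E :=
  [set y | exists2 j, j \in s & U j y].

Lemma union_of_nil (I : eqType) (U : I -> set E) : union_of [::] U = set0.
Proof. by apply/seteqP; split=> y // []. Qed.

Lemma union_of_cons (I : eqType) (j : I) s (U : I -> set E) :
  union_of (j :: s) U = U j `|` union_of s U.
Proof.
apply/seteqP; split=> y.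
  by move=> [i]; rewrite inE => /orP[/eqP -> Uy|si Uy]; [left|right; exists i].
by move=> [Uy|[i si Uy]]; [exists j|exists i] => //; rewrite inE ?eqxx ?si ?orbT.
Qed.

Lemma open_union_of (I : eqType) (s : seq I) (U : I -> set E) :
  (forall j, open (U j)) -> open (union_of s U).
Proof.
move=> oU; elim: s => [|j s IHs]; first by rewrite union_of_nil; exact: open0.
by rewrite union_of_cons; exact: openU.
Qed.

(** Mayer-Vietoris by induction on the number of sets; the sets [PV] and [PU]
    collect the intersections taken on the way. The condition on nerves makes
    each final pair of convex sets either contractible or empty. *)
Lemma acyclic_same_nerve n (I : eqType) (s : seq I) (V U : I -> set E)
    (PV PU : set E) :
  open PV -> open PU -> convex_subset PV -> convex_subset PU -> PU `<=` PV ->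
  (forall j, open (V j)) -> (forall j, open (U j)) ->
  (forall j, convex_subset (V j)) -> (forall j, convex_subset (U j)) ->
  (forall j, U j `<=` V j) ->
  (forall J : seq I, J != [::] -> {subset J <= s} ->
    (exists2 y, PV y & forall j, j \in J -> V j y) ->
    (exists2 y, PU y & forall j, j \in J -> U j y)) ->
  acyclic_at n (PV `&` union_of s V) (PU `&` union_of s U).
Proof.
move=> oPV oPU cPV cPU PUV oV oU cV cU UV.
elim: s n PV PU oPV oPU cPV cPU PUV =>
  [|j s IHs] n PV PU oPV oPU cPV cPU PUV nerve.
  by rewrite !union_of_nil !setI0; exact: acyclic_at_refl.
have oPVj : open (PV `&` V j) by exact: openI.
have oPUj : open (PU `&` U j) by exact: openI.
have PUVj : PU `&` U j `<=` PV `&` V j by move=> y [/PUV ? /UV].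
have cPVj : convex_subset (PV `&` V j) by exact: convex_subsetI.
have cPUj : convex_subset (PU `&` U j) by exact: convex_subsetI.
rewrite !union_of_cons !setIUr; apply: mayer_vietoris => //.
- by apply: openI => //; exact: open_union_of.
- by apply: openI => //; exact: open_union_of.
- by move=> y [/PUV ? [i si /UV]]; split => //; exists i.
- have [[v [PVv Vv]]|noV] := pselect (PV `&` V j !=set0).
    have [|||w PUw Uw] := nerve [:: j].
    + by [].
    + by move=> i; rewrite inE => /eqP ->; rewrite mem_head.
    + by exists v => // i; rewrite inE => /eqP ->.
    have PUjw : (PU `&` U j) w by split => //; apply: Uw; rewrite mem_head.
    apply: (acyclic_star_shaped (v := w)) => //; apply: convex_subset_star => //.
    exact: PUVj.
  have PV0 : PV `&` V j = set0.
    by apply/seteqP; split=> // y PVy; case: noV; exists y.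
  have -> : PU `&` U j = set0 by apply/seteqP; split=> // y /PUVj; rewrite PV0.
  by rewrite PV0; exact: acyclic_at_refl.
- apply: IHs => // J J0 Js; apply: nerve => // i /Js.
  by rewrite inE => ->; rewrite orbT.
case: n => // n.
have -> : PV `&` V j `&` (PV `&` union_of s V) = PV `&` V j `&` union_of s V.
  by rewrite setIA (setIC (PV `&` V j)) setIA setIid.
have -> : PU `&` U j `&` (PU `&` union_of s U) = PU `&` U j `&` union_of s U.
  by rewrite setIA (setIC (PU `&` U j)) setIA setIid.
apply: IHs => // J J0 Js [y [PVy Vy] VJ].
have [|||w PUw Uw] := nerve (j :: J).
- by [].
- by move=> i; rewrite !inE => /orP[->//|/Js ->]; rewrite orbT.
- by exists y => // i; rewrite inE => /orP[/eqP ->|/VJ].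
exists w; first by split => //; apply: Uw; rewrite mem_head.
by move=> i iJ; apply: Uw; rewrite inE iJ orbT.
Qed.

(** The nerve of r convex sets has dimension at most r - 1, and r - 2 unless it is
    a full simplex; relatively to the whole space, the homology is zero in
    positive degrees from r on. *)
Lemma acyclic_union_convex n (I : eqType) (s : seq I) (U : I -> set E) (P : set E) :
  open P -> convex_subset P ->
  (forall j, open (U j)) -> (forall j, convex_subset (U j)) ->
  (maxn 1 (size s) <= n)%N ->
  acyclic_at n setT (P `&` union_of s U).
Proof.
move=> oP cP oU cU; elim: s n P oP cP => [|j s IHs] [|n] P oP cP //=.
  move=> _; rewrite union_of_nil setI0; apply: (acyclic_star_shaped_set0 (v := 0)).
  by [].
  by rewrite geq_max.
rewrite geq_max /= => sn.
have oPj : open (P `&` U j) by exact: openI.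
have cPj : convex_subset (P `&` U j) by exact: convex_subsetI.
have acj : acyclic_at n.+1 setT (P `&` U j).
  have [[v Pv]|noP] := pselect (P `&` U j !=set0).
    by apply: (acyclic_star_shaped (v := v)) => //; exact: convex_subset_star.
  have -> : P `&` U j = set0.
    by apply/seteqP; split=> // y Py; case: noP; exists y.
  exact: (acyclic_star_shaped_set0 (v := 0)).
case: s IHs sn => [|j' s] IHs sn.
  by rewrite union_of_cons union_of_nil setU0.
rewrite union_of_cons setIUr -[setT]setUid; apply: mayer_vietoris => //.
- exact: openT.
- exact: openT.
- by apply: openI => //; exact: open_union_of.
- by apply: IHs => //; move: sn => /=; lia.
rewrite setIid.
have -> : P `&` U j `&` (P `&` union_of (j' :: s) U) =
    P `&` U j `&` union_of (j' :: s) U.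
  by rewrite setIA (setIC (P `&` U j)) setIA setIid.
by apply: IHs => //; move: sn => /=; lia.
Qed.

End ConvexCovers.

Section Polyhedra.
Context {R : realType} {K : comNzRingType} {N r : nat} (A : 'M[R]_(N, r)).
Local Notation E := ('rV[R]_N).
Local Notation acyclic_at := (@acyclic_at R E K).
Implicit Types (c : 'rV[R]_r) (x y : E).

Definition polyhedron c : set E := [set y | forall j, (y *m A) 0 j <= c 0 j].

Definition half_space c (j : 'I_r) : set E := [set y | c 0 j < (y *m A) 0 j].

Lemma open_half_space c j : open (half_space c j).
Proof.
have cA : continuous (fun y : E => (y *m A) 0 j).
  move=> y; apply: (@continuous_comp _ _ _ (fun y : E => y *m A)
    (fun z : 'rV[R]_r => z 0 j)); first exact: continuous_mulmx.
  exact: continuous_coord.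
by move/continuousP: cA => /(_ _ (@open_gt R (c 0 j))).
Qed.

Lemma convex_half_space c j : convex_subset (half_space c j).
Proof.
move=> x y a; rewrite /half_space /= => cx cy /andP[a0 a1].
rewrite mulmxDl -scalemxAl mulmxBl !mxE.
move: cx cy; rewrite !mxE; set X := \sum_i _; set Y := \sum_i _ => cx cy.
have -> : X + a * (Y - X) = (1 - a) * X + a * Y by ring.
have [->|an0] := eqVneq a 0; first by rewrite subr0 mul1r mul0r addr0.
have a_gt0 : 0 < a by rewrite lt_def an0.
have -> : c 0 j = (1 - a) * c 0 j + a * c 0 j by ring.
apply: ler_ltD; last by rewrite ltr_pM2l.
by apply: ler_wpM2l; [rewrite subr_ge0|exact: ltW].
Qed.

Lemma compl_polyhedron c :
  ~` polyhedron c = union_of (enum 'I_r) (half_space c).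
Proof.
apply/seteqP; split=> y /=.
  by move=> /existsNP[j /negP]; rewrite -ltNge => ?; exists j; rewrite ?mem_enum.
by move=> [j _ cy] /(_ j); rewrite leNgt => /negP.
Qed.

Lemma open_compl_polyhedron c : open (~` polyhedron c).
Proof.
by rewrite compl_polyhedron; apply: open_union_of => j; exact: open_half_space.
Qed.

Lemma polyhedronI c c' : polyhedron c `&` polyhedron c' =
  polyhedron (\row_j Num.min (c 0 j) (c' 0 j)).
Proof.
apply/seteqP; split=> y /=.
  by move=> [yc yc'] j; rewrite mxE le_min yc yc'.
by move=> yc; split=> j; have := yc j; rewrite mxE le_min => /andP[].
Qed.

Lemma acyclic_compl_polyhedron n c : (maxn 1 r <= n)%N ->
  acyclic_at n setT (~` polyhedron c).
Proof.
move=> rn; rewrite compl_polyhedron -[union_of _ _]setTI.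
apply: acyclic_union_convex => //; first exact: openT.
- by move=> j; exact: open_half_space.
- by move=> j; exact: convex_half_space.
by rewrite size_enum_ord.
Qed.

(** The half-spaces around [x] and those around the polyhedron have the same
    nerve: a point [y] in some of the former moves into the corresponding ones
    of the latter when scaled away from [x]. *)
Lemma acyclic_polyhedron_point n c x : polyhedron c x ->
  acyclic_at n (~` polyhedron (x *m A)) (~` polyhedron c).
Proof.
move=> cx; rewrite !compl_polyhedron -[X in acyclic_at _ X]setTI.
rewrite -[X in acyclic_at _ _ X]setTI.
apply: acyclic_same_nerve => //; try exact: openT.
- by move=> j; exact: open_half_space.
- by move=> j; exact: open_half_space.
- by move=> j; exact: convex_half_space.
- by move=> j; exact: convex_half_space.
- by move=> j y; apply: le_lt_trans; exact: cx.
move=> J _ _ [y _ xy].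
(* Every scaling factor above all the l j moves y - x past the level c j. *)
pose l (j : 'I_r) : R := `|c 0 j| / ((y *m A) 0 j - (x *m A) 0 j).
pose L : R := 1 + \sum_(j <- J) l j.
exists (L *: (y - x)) => // j jJ.
have l_ge0 i : i \in J -> 0 <= l i.
  by move=> /xy h; rewrite divr_ge0 // subr_ge0 ltW.
have Ll : l j < L.
  rewrite /L (big_rem j) //= addrA addrAC ltrDr ltr_pwDl // big_seq sumr_ge0 //.
  by move=> i /mem_rem; exact: l_ge0.
have d0 : 0 < (y *m A) 0 j - (x *m A) 0 j by rewrite subr_gt0; exact: xy.
rewrite /half_space /= -scalemxAl mulmxBl.
have -> : (L *: (y *m A - x *m A)) 0 j = L * ((y *m A) 0 j - (x *m A) 0 j).
  by rewrite !mxE.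
apply: (le_lt_trans (ler_norm _)).
by move: Ll; rewrite /l ltr_pdivrMr.
Qed.

End Polyhedra.

(** * A polyhedral model of small cells *)

Section SimplexCells.
Context {R : realType} {N : nat}.
Implicit Types (c : 'rV[R]_N.+1) (x y : 'rV[R]_N).

(** The linear forms whose sublevel sets are the homothetic copies of a
    simplex: the sum of the coordinates and the opposite of each coordinate. *)
Definition simplex_forms : 'M[R]_(N, N.+1) :=
  \matrix_(i, j) (if fintype.unlift ord0 j is Some k then - (i == k)%:R else 1).

Lemma simplex_forms0 y : (y *m simplex_forms) 0 ord0 = \sum_i y 0 i.
Proof.
by rewrite mxE; apply: eq_bigr => i _; rewrite mxE unlift_none mulr1.
Qed.

Lemma simplex_formsS y i :
  (y *m simplex_forms) 0 (fintype.lift ord0 i) = - y 0 i.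
Proof.
rewrite mxE (bigD1 i) //= big1 => [|k ki]; rewrite mxE liftK.
  by rewrite eqxx mulrN1 addr0.
by rewrite (negbTE ki) oppr0 mulr0.
Qed.

(** The coordinate [i] is bounded below by its own form, and above by the sum of
    all coordinates minus the other ones. *)
Lemma simplex_forms_bound y (d : 'rV[R]_N.+1) i : (forall j, 0 <= d 0 j) ->
  polyhedron simplex_forms d y -> `|y 0 i| <= \sum_j d 0 j.
Proof.
move=> d0 yd.
have yi k : - y 0 k <= d 0 (fintype.lift ord0 k).
  by have := yd (fintype.lift ord0 k); rewrite simplex_formsS.
have ys : \sum_k y 0 k <= d 0 ord0 by have := yd ord0; rewrite simplex_forms0.
have dS : 0 <= \sum_(k | k != i) d 0 (fintype.lift ord0 k) by exact: sumr_ge0.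
rewrite big_ord_recl (bigD1 i) //= ler_norml; apply/andP; split.
  rewrite lerNl; apply: (le_trans (yi i)).
  by rewrite addrCA lerDl addr_ge0.
have -> : y 0 i = \sum_k y 0 k + \sum_(k | k != i) - y 0 k.
  by rewrite sumrN [X in _ = X - _](bigD1 i) //= addrK.
apply: lerD => //; apply: (@le_trans _ _ (\sum_(k | k != i) d 0 (fintype.lift ord0 k))).
  exact: ler_sum.
by rewrite lerDr.
Qed.

Lemma polyhedron_point x : polyhedron simplex_forms (x *m simplex_forms) = [set x].
Proof.
apply/seteqP; split=> y /=; last by move=> -> j.
move=> yx; have y0 : polyhedron simplex_forms (0 : 'rV_N.+1) (y - x).
  by move=> j; rewrite mulmxBl !mxE; have := yx j; rewrite !mxE subr_le0.
apply/eqP; rewrite -subr_eq0; apply/eqP/rowP => i.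
have := simplex_forms_bound i _ y0; rewrite big1 => [|j _]; last by rewrite mxE.
move=> h; have /h : forall j, 0 <= (0 : 'rV[R]_N.+1) 0 j by move=> j; rewrite mxE.
by rewrite normr_le0 => /eqP ->; rewrite mxE.
Qed.

Lemma polyhedron_compact c : compact (polyhedron simplex_forms c).
Proof.
pose B : R := \sum_j `|c 0 j|.
have cube := @rV_compact R N (fun=> `[- B, B]%classic)
  (fun=> @segment_compact R (- B) B).
apply: (subclosed_compact _ cube) => [|y yc i].
  by rewrite -[polyhedron _ _]setCK; apply: open_closedC; exact: open_compl_polyhedron.
rewrite /= in_itv /= -ler_norml.
pose d : 'rV[R]_N.+1 := \row_j `|c 0 j|.
have -> : B = \sum_j d 0 j by apply: eq_bigr => j _; rewrite mxE.
apply: simplex_forms_bound => j; first by rewrite mxE.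
by rewrite [leRHS]mxE (le_trans (yc j)) // ler_norm.
Qed.

Lemma nbhs_polyhedron x (O : set 'rV[R]_N) : nbhs x O ->
  exists c, [/\ nbhs x (polyhedron simplex_forms c),
    polyhedron simplex_forms c x & polyhedron simplex_forms c `<=` O].
Proof.
move=> /nbhs_rowP[e e0 eO].
(* The bound of simplex_forms_bound adds N + 1 copies of d. *)
pose d := e / N.+2%:R.
have d0 : 0 < d by rewrite divr_gt0 ?ltr0n.
have shift y (c : 'rV[R]_N.+1) : polyhedron simplex_forms c (y - x) <->
    polyhedron simplex_forms (x *m simplex_forms + c) y.
  by split=> h j; have := h j; rewrite mulmxBl;
    move: (y *m _) (x *m _) => Y X; rewrite !mxE lerBlDl.
exists (x *m simplex_forms + const_mx d); split.
- have dN : 0 < d / N.+1%:R by rewrite divr_gt0 ?ltr0n.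
  apply: filterS (nbhs_row_ball x dN) => y xy; apply/shift => j; rewrite [leRHS]mxE.
  have yx i : `|(y - x) 0 i| <= d / N.+1%:R.
    by rewrite !mxE distrC ltW.
  case: (unliftP ord0 j) => [i|] ->.
    rewrite simplex_formsS (le_trans (ler_norm _)) // normrN (le_trans (yx i)) //.
    by rewrite ler_pdivrMr ?ltr0n // -[leLHS]mulr1 ler_pM2l // ler1n.
  rewrite simplex_forms0 (le_trans (ler_norm _)) // (le_trans (ler_norm_sum _ _ _)) //.
  apply: (@le_trans _ _ (\sum_(i < N) (d / N.+1%:R))); first exact: ler_sum.
  rewrite sumr_const card_ord -[_ *+ N]mulr_natr -mulrA ger_pMr //.
  by rewrite mulrC ler_pdivrMr ?ltr0n // mul1r ler_nat.
- by apply/shift => j; rewrite subrr mul0mx !mxE ltW.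
move=> y /shift yd; apply: eO => i; rewrite distrC.
have := simplex_forms_bound i _ yd; rewrite !mxE => h.
apply: le_lt_trans (h _) _; first by move=> j; rewrite mxE ltW.
under eq_bigr do rewrite mxE.
rewrite sumr_const card_ord -[_ *+ _]mulr_natr -mulrA gtr_pMr //.
by rewrite mulrC ltr_pdivrMr ?ltr0n // mul1r ltr_nat.
Qed.

End SimplexCells.

(** * Chains in a chart *)

Section Embedding.
Context {R : realType} {K : comNzRingType} {E M : topologicalType}.
Context (phi : E -> M) (phi_continuous : continuous phi)
  (phi_inj : injective phi) (phi_open : forall O, open O -> open (phi @` O)).

Lemma simplex_image_continuous n (s : singular_simplex R E n) :
  continuous (phi \o s).
Proof. by move=> t; apply: continuous_comp; [exact: cts_fun|exact: phi_continuous]. Qed.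

Definition simplex_image n (s : singular_simplex R E n) : singular_simplex R M n :=
  mkcts (@simplex_image_continuous n s).

Lemma simplex_imageE n (s : singular_simplex R E n) t :
  simplex_image s t = phi (s t).
Proof. by []. Qed.

Lemma simplex_image_inj n : injective (@simplex_image n).
Proof.
move=> s s' ss'; apply: simplex_eq => t; apply: phi_inj.
by rewrite -!simplex_imageE ss'.
Qed.

Lemma face_simplex_image n i (s : singular_simplex R E n.+1) :
  face i (simplex_image s) = simplex_image (face i s).
Proof. exact: simplex_eq. Qed.

Lemma range_simplex_image n (s : singular_simplex R E n) A :
  range (simplex_image s) `<=` phi @` A <-> range s `<=` A.
Proof.
split=> sA.
  move=> _ [t _ <-]; have [|x Ax /phi_inj <-//] := sA (simplex_image s t).
  by exists t.
by move=> _ [t _ <-]; exists (s t) => //; apply: sA; exists t.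
Qed.

(** The lift is continuous because an open embedding identifies the open sets of
    [E] with open sets of [M]. *)
Lemma simplex_lift n (s : singular_simplex R M n) :
  range s `<=` range phi -> exists s' : singular_simplex R E n, simplex_image s' = s.
Proof.
move=> sphi; have /choice[f fE] : forall t, exists x, phi x = s t.
  by move=> t; have [|x _ xs] := sphi (s t); [exists t|exists x].
have cf : continuous f.
  apply/continuousP => O oO.
  have -> : f @^-1` O = s @^-1` (phi @` O).
    apply/seteqP; split=> t /=; first by move=> Of; exists (f t).
    by move=> [x Ox]; rewrite -fE => /phi_inj <-.
  have /continuousP := @cts_fun _ _ s; apply; exact: phi_open.
exists (mkcts cf : singular_simplex R E n).
by apply: simplex_eq => t; rewrite simplex_imageE -fE.
Qed.

Definition chain_image n : chain R E K n -> chain R M K n :=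
  fglift (fun s => << simplex_image s >>).

HB.instance Definition _ n := GRing.Linear.copy (@chain_image n)
  (fglift (fun s => << simplex_image s >>)).

Lemma boundary_chain_image n (c : chain R E K n.+1) :
  boundary (chain_image c) = chain_image (boundary c).
Proof.
move: c; refine (linear_freeg_eq (f := @boundary R M K n \o @chain_image _)
  (g := @chain_image _ \o @boundary R E K n) _); move=> s /=.
rewrite /chain_image fgliftU !boundaryU linear_sum; apply: eq_bigr => i _.
by rewrite linearZ /= fgliftU face_simplex_image.
Qed.

Lemma coeff_chain_image n (s : singular_simplex R E n) (c : chain R E K n) :
  coeff (simplex_image s) (chain_image c) = coeff s c.
Proof.
elim/(@freeg_lin_ind K (singular_simplex R E n)): c => [|c d IHc IHd|k c IHc|t].
- by rewrite linear0 !coeff0.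
- by rewrite linearD !coeffD IHc IHd.
- by rewrite linearZ !coeffZ IHc.
- by rewrite /chain_image fgliftU !coeffU (inj_eq (@simplex_image_inj n)).
Qed.

Lemma chain_in_image n A (c : chain R E K n) :
  chain_in (phi @` A) (chain_image c) <-> chain_in A c.
Proof.
split=> /chain_inE cA; apply/chain_inE.
  by move=> s; rewrite -coeff_chain_image => /cA /range_simplex_image.
apply: supported_lift cA => s sA; apply: supportedU.
by rewrite range_simplex_image.
Qed.

Lemma chain_lift n (c : chain R M K n) :
  chain_in (range phi) c -> exists c', chain_image c' = c.
Proof.
move=> /chain_inE; move: c; apply: supported_ind =>
  [|c d [c' <-] [d' <-]|k c [c' <-]|s sphi].
- by exists 0; rewrite linear0.
- by exists (c' + d'); rewrite linearD.
- by exists (k *: c'); rewrite linearZ.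
- have [s' <-] := simplex_lift sphi.
  by exists << s' >>; rewrite /chain_image fgliftU.
Qed.

Lemma acyclic_at_image n V U : acyclic_at (R := R) (K := K) n V U ->
  acyclic_at (R := R) (K := K) n (phi @` V) (phi @` U).
Proof.
move=> ac c cV cU.
have [|c' c'c] := @chain_lift n c; first by apply: chain_inS cV; exact: image_subset.
have c'V : chain_in V c' by apply/chain_in_image; rewrite c'c.
have c'U : is_relative_cycle U c'.
  case: n c c' cV cU c'c c'V {ac} => //= n c c' cV cU c'c c'V.
  by apply/chain_in_image; rewrite -boundary_chain_image c'c.
have [b bV bU] := ac c' c'V c'U; exists (chain_image b).
  exact/chain_in_image.
by rewrite -c'c boundary_chain_image -linearB; exact/chain_in_image.
Qed.

(** Excision of the complement of the chart. *)
Lemma acyclic_at_chart n V D : closed (phi @` D) -> open V -> ~` D `<=` V ->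
  acyclic_at (R := R) (K := K) n V (~` D) ->
  acyclic_at (R := R) (K := K) n (~` (phi @` (~` V))) (~` (phi @` D)).
Proof.
move=> clD oV DV ac.
have oD : open (~` (phi @` D)) by exact: closed_openC.
have -> : ~` (phi @` (~` V)) = ~` (phi @` D) `|` phi @` V.
  apply/seteqP; split=> x.
    move=> nVx; have [[y Dy yx]|] := pselect ((phi @` D) x); last by left.
    by right; exists y => //; apply: contrapT => nVy; apply: nVx; exists y.
  move=> [nDx|[y Vy <-]] [z nVz] => [zx|/phi_inj zy].
    by apply: nDx; exists z => //; apply: contrapT => /DV.
  by apply: nVz; rewrite zy.
apply: excision => //; first exact: phi_open.
have -> : ~` (phi @` D) `&` phi @` V = phi @` (~` D).
  apply/seteqP; split=> x.
    by move=> [nDx [y Vy yx]]; exists y => // Dy; apply: nDx; exists y.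
  move=> [y nDy <-]; split; last by exists y => //; exact: DV.
  by move=> [z Dz /phi_inj zy]; apply: nDy; rewrite -zy.
exact: acyclic_at_image.
Qed.

End Embedding.

Section ChainSupport.
Context {R : realType} {K : comNzRingType} {M : topologicalType}.

Lemma range_simplex_compact n (s : singular_simplex R M n) : compact (range s).
Proof.
have -> : range s = extend s @` std_simplex R n.
  apply/seteqP; split=> x [t].
    by move=> _ <-; exists (set_val t); [exact: set_mem (valP t)|exact: extend_val].
  by move=> _ <-; exact: extend_range.
apply: continuous_compact; last exact: std_simplex_compact.
by apply: continuous_subspaceT; exact: extend_continuous.
Qed.

Lemma chain_support (hM : hausdorff_space M) n (c : chain R M K n) :
  exists S : set M, [/\ closed S, chain_in S c &
    forall A, chain_in A c -> S `<=` A].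
Proof.
exists [set x | exists2 s : singular_simplex R M n, s \in dom c & range s x].
split=> [|s sc x sx|A cA x [s sc sx]]; [|by exists s|exact: cA sx].
elim: (dom c) => [|s l IHl].
  have -> : [set x | exists2 s : singular_simplex R M n, s \in [::] & range s x] = set0.
    by apply/seteqP; split=> x // [].
  exact: closed0.
have -> : [set x | exists2 t, t \in s :: l & range t x] =
    range s `|` [set x | exists2 t : singular_simplex R M n, t \in l & range t x].
  apply/seteqP; split=> x.
    by move=> [t]; rewrite inE => /orP[/eqP ->|tl] tx; [left|right; exists t].
  by move=> [sx|[t tl tx]]; [exists s|exists t] => //; rewrite inE ?eqxx ?tl ?orbT.
by apply: closedU => //; apply: compact_closed => //; exact: range_simplex_compact.
Qed.

End ChainSupport.

(** * Top-dimensional cycles of a closed manifold *)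

Section Cells.
Context {R : realType} {K : comNzRingType} {N : nat} {M : topologicalType}.
Local Notation acyclic_at := (@acyclic_at R M K).
Local Notation polyhedron := (polyhedron (@simplex_forms R N)).
Context (hausM : hausdorff_space M).

Definition open_embedding (phi : 'rV[R]_N -> M) :=
  [/\ continuous phi, injective phi & forall O, open O -> open (phi @` O)].

Definition cell (B : set M) :=
  exists phi c, open_embedding phi /\ B = phi @` polyhedron c.

Lemma image_compact (phi : 'rV[R]_N -> M) C :
  continuous phi -> compact C -> compact (phi @` C).
Proof. by move=> cphi; apply: continuous_compact; exact: continuous_subspaceT. Qed.

Lemma cell_closed B : cell B -> closed B.
Proof.
move=> [phi [c [[cphi _ _] ->]]]; apply: compact_closed => //.
by apply: image_compact => //; exact: polyhedron_compact.
Qed.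

(** In the chart both sets are complements of simplices, one of them reduced to
    a point, and outside of the chart they agree. *)
Lemma acyclic_cell_point n B x : cell B -> B x -> acyclic_at n (~` [set x]) (~` B).
Proof.
move=> cB; have := cell_closed cB; case: cB => phi [c [[cphi iphi ophi] ->]] clB.
move=> [y cy <-]; rewrite -image_set1 -polyhedron_point.
rewrite -[X in phi @` X]setCK.
apply: acyclic_at_chart => //.
- exact: open_compl_polyhedron.
- by apply: subsetC => z; rewrite polyhedron_point => ->.
exact: acyclic_polyhedron_point.
Qed.

(** Induction with [acyclic_at_setI]: the intersection of one simplex with the union
    of the others is again a union of such simplices, one fewer, because
    homothetic simplices are stable under intersection. *)
Lemma acyclic_chart_polyhedra n (phi : 'rV[R]_N -> M) (cs : seq 'rV[R]_N.+1) :
  open_embedding phi -> (N < n)%N ->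
  acyclic_at n setT (~` (phi @` union_of cs polyhedron)).
Proof.
move=> [cphi iphi ophi]; have [m] := ubnP (size cs).
have cl c : closed (phi @` polyhedron c).
  by apply: compact_closed => //; apply: image_compact => //; exact: polyhedron_compact.
have clU s : closed (phi @` union_of s polyhedron).
  elim: s => [|c s IHs]; first by rewrite union_of_nil image_set0; exact: closed0.
  by rewrite union_of_cons image_setU; apply: closedU.
elim: m n cs => // m IHm n [|c cs] /=.
  by move=> _ _; rewrite union_of_nil image_set0 setC0; exact: acyclic_at_refl.
rewrite ltnS => sm Nn; rewrite union_of_cons image_setU setCU.
apply: acyclic_at_setI.
- exact: closed_openC.
- exact: closed_openC.
- have : acyclic_at n (~` (phi @` (~` setT))) (~` (phi @` polyhedron c)).
    apply: acyclic_at_chart => //; first exact: openT.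
    by apply: acyclic_compl_polyhedron; rewrite geq_max Nn (leq_trans _ Nn).
  by rewrite setCT image_set0 setC0.
- exact: IHm.
rewrite -setCI.
have -> : phi @` polyhedron c `&` phi @` union_of cs polyhedron =
    phi @` union_of
      [seq \row_j Num.min (c 0 j) ((c' : 'rV_N.+1) 0 j) | c' <- cs] polyhedron.
  apply/seteqP; split=> x.
    move=> [[y cy <-] [z [c' cs' c'z] /iphi zy]]; exists y => //.
    exists (\row_j Num.min (c 0 j) (c' 0 j)); first exact: map_f.
    by rewrite -polyhedronI; split => //; rewrite -zy.
  move=> [y [_ /mapP[c' cs' ->]]]; rewrite -polyhedronI => -[cy c'y] <-.
  by split; exists y => //; exists c'.
by apply: IHm; rewrite ?size_map // ltnW.
Qed.

(** The support of a boundary is compact, so a relative cycle modulo the complement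
    of the image of [C] is one modulo the complement of finitely many simplices
    covering that image. *)
Lemma acyclic_chart_closed n (phi : 'rV[R]_N -> M) (C : set 'rV[R]_N) :
  open_embedding phi -> compact C -> (N < n)%N ->
  acyclic_at n setT (~` (phi @` C)).
Proof.
move=> ephi cC; case: n => // n Nn c _ /= cU.
have [S [clS bS Smin]] := chain_support hausM (boundary c).
have SC : S `<=` ~` (phi @` C) by exact: Smin.
have [cs Ccs csS] : exists2 cs : seq 'rV[R]_N.+1, C `<=` union_of cs polyhedron &
    union_of cs polyhedron `<=` phi @^-1` (~` S).
  apply: (@compact_ind _ (fun A => exists2 cs, A `<=` union_of cs polyhedron &
    union_of cs polyhedron `<=` phi @^-1` (~` S))) => //.
  - by exists [::]; rewrite union_of_nil.
  - move=> A B [s As sS] [t Bt tS]; exists (s ++ t).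
      by move=> y [/As|/Bt] [c' sc c'y]; exists c' => //; rewrite mem_cat sc ?orbT.
    move=> y [c']; rewrite mem_cat => /orP[c's|c't] c'y.
      by apply: sS; exists c'.
    by apply: tS; exists c'.
  - by move=> A B AB [s Bs sS]; exists s => //; exact: subset_trans Bs.
  move=> y Cy; have : nbhs y (phi @^-1` (~` S)).
    case: ephi => cphi _ _; apply: cphi; apply: open_nbhs_nbhs; split.
      exact: closed_openC.
    by move=> Sy; apply: (SC _ Sy); exists y.
  move=> /nbhs_polyhedron[c' [yc' _ c'S]]; exists (polyhedron c') => //.
  exists [:: c'] => [z c'z|z [c'']]; first by exists c'; rewrite ?mem_head.
  by rewrite inE => /eqP ->; exact: c'S.
have [||b _ bU] := @acyclic_chart_polyhedra n.+1 phi cs ephi Nn c.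
- exact: chain_inT.
- by rewrite /=; apply: chain_inS bS => x Sx [y /csS + yx]; rewrite /= yx.
exists b; first exact: chain_inT.
by apply: chain_inS bU; apply: subsetC; exact: image_subset.
Qed.

Lemma acyclic_closed_in_cell n B C : cell B -> closed C -> C `<=` B ->
  (N < n)%N -> acyclic_at n setT (~` C).
Proof.
move=> [phi [c [ephi BE]]] clC CB Nn.
have CE : C = phi @` (phi @^-1` C).
  apply/seteqP; split=> [x Cx|_ [y Cy <-]//].
  by have := CB _ Cx; rewrite BE => -[y _ yx]; exists y => //; rewrite /= yx.
rewrite CE; apply: acyclic_chart_closed => //.
apply: (subclosed_compact _ (@polyhedron_compact R N c)).
  case: ephi => cphi _ _; move/continuousP: cphi => /(_ _ (closed_openC clC)).
  by rewrite preimage_setC openC.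
move=> y /CB; rewrite BE => -[z cz]; case: ephi => _ iphi _ /iphi <-.
exact: cz.
Qed.

(** The class of [c] in H_N(M, M - x) is zero. *)
Definition vanishes_at (c : chain R M K N) (x : M) :=
  exists b, chain_in (~` [set x]) (c - boundary b).

Lemma vanishes_on_cell (c : chain R M K N) B x :
  is_cycle c -> cell B -> B x -> vanishes_at c x ->
  exists b, chain_in (~` B) (c - boundary b).
Proof.
move=> cycc cB Bx [b bx].
have [||b' _ b'B] := @acyclic_cell_point N B x cB Bx (c - boundary b).
- exact: bx.
- apply: relative_cycleB; last exact: boundary_relative_cycle.
  exact: cycle_relative_cycle.
by exists (b + b'); rewrite linearD /= opprD addrA.
Qed.

(** Gluing one cell at a time; the intersection of a cell with the union of the
    others is a closed set in a chart, to which the vanishing above degree [N]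
    applies. *)
Lemma vanishes_on_cells (c : chain R M K N) (Bs : seq (set M)) :
  is_cycle c -> (forall B, B \in Bs -> cell B) ->
  (forall x, vanishes_at c x) ->
  closed [set x | exists2 B, B \in Bs & B x] /\
  exists b, chain_in (~` [set x | exists2 B, B \in Bs & B x]) (c - boundary b).
Proof.
move=> cycc + cx; elim: Bs => [_|B Bs IHBs cBs].
  have -> : [set x | exists2 B : set M, B \in [::] & B x] = set0.
    by apply/seteqP; split=> x // [].
  by split; [exact: closed0|exists 0; rewrite setC0; exact: chain_inT].
have [|clBs [b bBs]] := IHBs; first by move=> B' B'Bs; apply: cBs; rewrite inE B'Bs orbT.
have cB : cell B by apply: cBs; rewrite mem_head.
have clB := cell_closed cB.
have -> : [set x | exists2 B' : set M, B' \in B :: Bs & B' x] =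
    B `|` [set x | exists2 B' : set M, B' \in Bs & B' x].
  apply/seteqP; split=> x.
    by move=> [B']; rewrite inE => /orP[/eqP ->|B'Bs] B'x; [left|right; exists B'].
  by move=> [Bx|[B' B'Bs B'x]]; [exists B|exists B'] => //; rewrite inE ?eqxx ?B'Bs ?orbT.
split; first exact: closedU.
rewrite setCU; apply: bounds_mod_setI.
- exact: closed_openC.
- exact: closed_openC.
- rewrite -setCI; apply: (acyclic_closed_in_cell cB) => //.
  exact: closedI.
- exact: cycle_relative_cycle.
- have [->|/set0P[x Bx]] := eqVneq B set0.
    by exists 0; rewrite setC0; exact: chain_inT.
  exact: (vanishes_on_cell cycc cB Bx).
by exists b.
Qed.

End Cells.

Section ClosedManifold.
Context {R : realType} {K : comNzRingType} {N : nat} {M : topologicalType}.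
Context (hM : closed_connected_manifold R N M).

Lemma manifold_chart (x : M) :
  exists2 phi : 'rV[R]_N -> M, open_embedding phi & range phi x.
Proof.
have [U [oU Ux] [f [g [fK gK]]]] := manifold_locally_euclidean hM x.
exists (fun y => set_val (g y)); last first.
  exists (f (exist _ x (mem_set Ux))) => //.
  by rewrite fK.
split.
- move=> y; apply: (continuous_comp (f := g)); first exact: cts_fun.
  exact: initial_continuous.
- by move=> y y' /val_inj /(can_inj gK).
move=> O oO.
have : open ((f : _ -> _) @^-1` O) by move/continuousP: (@cts_fun _ _ f); apply.
move=> [V oV VE].
have -> : [set set_val (g y) | y in O] = V `&` U.
  apply/seteqP; split=> z.
    move=> [y Oy <-]; split; last exact: set_mem (valP (g y)).
    have : (set_val @^-1` V) (g y) by rewrite VE /= gK.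
    by [].
  move=> [Vz Uz]; pose u : set_type U := exist _ z (mem_set Uz).
  exists (f u); last by rewrite fK.
  have : (set_val @^-1` V) u by [].
  by rewrite VE.
exact: openI.
Qed.

Lemma manifold_cell (x : M) : exists2 B, nbhs x B & cell (R := R) (N := N) B.
Proof.
have [phi ephi [y _ yx]] := manifold_chart x.
have [c [yc _ _]] := nbhs_polyhedron (filterT (F := nbhs y)).
exists (phi @` polyhedron simplex_forms c); last by exists phi, c.
case: ephi => cphi iphi ophi.
apply: (@filterS _ (nbhs x) _ (phi @` (polyhedron simplex_forms c)°)).
  by apply: image_subset; exact: interior_subset.
by apply: open_nbhs_nbhs; split; [apply: ophi; exact: open_interior|exists y].
Qed.

Lemma cycle_vanishing_everywhere (c : chain R M K N) :
  is_cycle c -> (forall x, vanishes_at c x) -> exists b, c = boundary b.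
Proof.
move=> cycc cx.
have [Bs Bsc Bsx] : exists2 Bs : seq (set M),
    (forall B, B \in Bs -> cell (R := R) (N := N) B) &
    [set: M] `<=` [set x | exists2 B, B \in Bs & B x].
  apply: (@compact_ind _ (fun A => exists2 Bs : seq (set M),
    (forall B, B \in Bs -> cell (R := R) (N := N) B) &
    A `<=` [set x | exists2 B, B \in Bs & B x])).
  - by exists [::].
  - move=> A B [s sc As] [t tc Bt]; exists (s ++ t).
      by move=> C; rewrite mem_cat => /orP[/sc|/tc].
    by move=> x [/As|/Bt] [C Cs Cx]; exists C => //; rewrite mem_cat Cs ?orbT.
  - by move=> A B AB [s sc Bs]; exists s => //; exact: subset_trans Bs.
  - exact: manifold_compact hM.
  move=> x _; have [B xB cB] := manifold_cell x; exists B => //.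
  exists [:: B] => [B'|y By]; first by rewrite inE => /eqP ->.
  by exists B => //; rewrite mem_head.
have [_ [b bBs]] := vanishes_on_cells (manifold_hausdorff hM) cycc Bsc cx.
exists b; apply/eqP; rewrite -subr_eq0; apply/eqP/chain_in_set0.
by apply: chain_inS bBs => x; apply; exact: Bsx.
Qed.

(** On a cell the class vanishes at every point or at none. As the cells around a
    point are neighborhoods, the points where it vanishes form a set that is both
    open and closed, and [M] is connected. *)
Lemma cycle_vanishing_somewhere (c : chain R M K N) x :
  is_cycle c -> vanishes_at c x -> exists b, c = boundary b.
Proof.
move=> cycc cx; apply: cycle_vanishing_everywhere => // y.
pose A := [set y | vanishes_at c y].
have cellA B z y' : cell (R := R) (N := N) B -> B z -> B y' -> A z -> A y'.
  move=> cB Bz By' Az.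
  have [b bB] := vanishes_on_cell (manifold_hausdorff hM) cycc cB Bz Az.
  by exists b; apply: chain_inS bB => w nBw wy'; apply: nBw; rewrite wy'.
suff AT : A = setT by have : A y by rewrite AT.
have oA : open A.
  rewrite openE => z Az; have [B zB cB] := manifold_cell z.
  apply: filterS (zB) => y' By'.
  exact: (cellA _ _ _ cB (nbhs_singleton zB) By' Az).
have clA : closed A.
  rewrite -openC openE => z nAz; have [B zB cB] := manifold_cell z.
  apply: filterS (zB) => y' By' Ay'; apply: nAz.
  exact: (cellA _ _ _ cB By' (nbhs_singleton zB) Ay').
apply: (manifold_connected hM); first by exists x.
- by exists A; rewrite ?setTI.
- by exists A; rewrite ?setTI.
Qed.

End ClosedManifold.

Section FundamentalClass.
Context {R : realType} {n : nat} {M : topologicalType} (o : M -> chain R M int n).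
Context (hM : closed_connected_manifold R n M) (ho : is_orientation o).

(** The orientation at one point x provides the multiple k: the class of e - k z
    vanishes at x, hence everywhere. *)
Lemma cycle_multiple_fundamental (z e : chain R M int n) :
  integral_fundamental_cycle o z -> is_cycle e ->
  exists (k : int) (b : chain R M int n.+1), e = k *: z + boundary b.
Proof.
move=> [cycz zo] cyce; have [x _] := manifold_nonempty hM.
have [_ ox] := orientation_generator ho x.
have [|k [b ebo]] := ox e.
  exact: cycle_relative_cycle.
exists k; suff [f ef] : exists f, e - k *: z = boundary f.
  by exists f; rewrite -ef addrC subrK.
apply: (cycle_vanishing_somewhere hM (x := x)).
  by apply: is_cycleB => //; exact: is_cycleZ.
have [f zof] := zo x; exists (b - k *: f).
have -> : boundary (b - k *: f) = boundary b - k *: boundary f.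
  by rewrite linearB linearZ.
have -> : e - k *: z - (boundary b - k *: boundary f) =
    (e - k *: o x - boundary b) - k *: (z - o x - boundary f).
  rewrite !scalerBr !opprB [RHS](AC (3*(1*2)) ((1*6)*(4*3)*(2*5))) /=.
  by rewrite addNr addr0.
by apply: chain_inB => //; exact: chain_inZ.
Qed.

End FundamentalClass.

(** * Integer matrices modulo almost all primes *)

Lemma intr_Fp_eq0 (p : nat) (k : int) : prime p ->
  (k%:~R == 0 :> 'F_p) = (p %| `|k|)%N.
Proof.
move=> pp; case: k => k /=; first by rewrite -pmulrn -(dvdn_pcharf (pchar_Fp pp)).
by rewrite NegzE mulrNz oppr_eq0 -pmulrn -(dvdn_pcharf (pchar_Fp pp)).
Qed.

Definition Fp_lift (p : nat) (x : 'F_p) : int := (x : nat)%:Z.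

Lemma Fp_liftK p (x : 'F_p) : (Fp_lift x)%:~R = x.
Proof. by rewrite /Fp_lift -pmulrn natr_Zp. Qed.

(** By the Smith normal form, the kernel of [B] modulo [p] is the reduction of
    the integral kernel unless [p] divides a nonzero invariant factor. *)
Lemma kernel_lift m (T : finType) (B : 'I_m -> T -> int) :
  exists2 D : nat, (0 < D)%N & forall p, prime p -> ~~ (p %| D)%N ->
    forall a : 'I_m -> 'F_p, (forall t, \sum_i a i * (B i t)%:~R = 0) ->
    exists b : 'I_m -> int,
      (forall i, (b i)%:~R = a i) /\ (forall t, \sum_i b i * B i t = 0).
Proof.
pose Bm : 'M[int]_(m, #|T|) := \matrix_(i, j) B i (enum_val j).
have [L Lu [Q Qu [d _ BE]]] := int_Smith_normal_form Bm.
set Dm := \matrix_(_, _) _ in BE.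
(* The product of the nonzero invariant factors. *)
pose w (i : 'I_m) : nat := if d`_i == 0 then 1%N else absz d`_i.
exists (\prod_(i < m) w i)%N.
  by apply: prodn_gt0 => i; rewrite /w; case: eqP => // /eqP; rewrite absz_gt0.
move=> p pp pD a aB; pose f := @intmul 'F_p 1.
pose av : 'rV['F_p]_m := \row_i a i.
have aBm : av *m map_mx f Bm = 0.
  apply/rowP => j; rewrite !mxE -[RHS](aB (enum_val j)).
  by apply: eq_bigr => i _; rewrite !mxE.
have [u uE] : exists u, u = av *m map_mx f L by exists (av *m map_mx f L).
have uD : u *m map_mx f Dm = 0.
  have := congr1 (mulmx^~ (map_mx f (invmx Q))) aBm; rewrite uE.
  rewrite BE !map_mxM /= mul0mx !mulmxA -(mulmxA _ (map_mx f Q)) -map_mxM.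
  by rewrite mulmxV // map_mx1 mulmx1.
have ud (i : 'I_m) : (i < #|T|)%N -> d`_i != 0 -> u 0 i = 0.
  move=> iT di; have /rowP/(_ (Ordinal iT)) := uD.
  rewrite mxE (bigD1 i) //= big1 => [|k ki]; rewrite !mxE /=; last first.
    by rewrite (_ : (k == i :> nat) = false) ?mulr0n ?rmorph0 ?mulr0 //; exact/negbTE.
  rewrite eqxx mulr1n addr0 => /eqP; rewrite mulf_eq0 => /orP[/eqP//|].
  rewrite /f intr_Fp_eq0 // => pd; case/negP: pD.
  by rewrite (bigD1 i) //= /w (negbTE di) dvdn_mulr.
(* In Smith coordinates: any lift, except for zero where the invariant factor
   forces the reduction to vanish. *)
pose v : 'rV[int]_m :=
  \row_i (if (i < #|T|)%N && (d`_i != 0) then 0 else Fp_lift (u 0 i)).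
have fv : map_mx f v = u.
  apply/rowP => i; rewrite mxE mxE; case: ifP => [/andP[iT di]|_].
    by rewrite ud // /f mulr0z.
  exact: Fp_liftK.
have vD : v *m Dm = 0.
  apply/rowP => j; rewrite !mxE big1 // => i _; rewrite !mxE.
  have [ij|] := eqVneq (i : nat) j; last by rewrite mulr0n mulr0.
  rewrite ij ltn_ord /=; have [->|] := eqVneq d`_j 0; first by rewrite mul0rn mulr0.
  by rewrite mul0r.
have [b bE] : exists b, b = v *m invmx L by exists (v *m invmx L).
have fb : map_mx f b = av.
  by rewrite bE map_mxM fv uE -mulmxA -map_mxM mulmxV // map_mx1 mulmx1.
have bB : b *m Bm = 0.
  by rewrite BE bE !mulmxA mulmxKV // vD mul0mx.
exists (fun i => b 0 i); split=> [i|t].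
  by have /rowP/(_ i) := fb; rewrite !mxE.
have /rowP/(_ (enum_rank t)) := bB; rewrite !mxE => bt; rewrite -[RHS]bt.
by apply: eq_bigr => i _; rewrite [in RHS]mxE enum_rankK.
Qed.

(** * Change of coefficients *)

Section ChangeCoefficients.
Context {R : realType} {M : topologicalType} {n : nat}.

Section Ring.
Context {K : comNzRingType}.

Lemma coeff_change (c : chain R M int n) s :
  coeff s (change_coefficients K c) = (coeff s c)%:~R.
Proof.
rewrite /change_coefficients raddf_sum /=.
have [sc|sc] := boolP (s \in dom c); last first.
  rewrite coeff_outdom // mulr0z big1_seq // => t /andP[_ tc].
  rewrite coeffU (negbTE (_ : t != s)) ?mulr0 //.
  by apply: contra sc => /eqP <-.
rewrite (bigD1_seq s) ?uniq_dom //= coeffU eqxx mulr1 big1 ?addr0 // => t ts.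
by rewrite coeffU (negbTE ts) mulr0.
Qed.

Lemma change_eq (c : chain R M int n) (d : chain R M K n) :
  (forall s, (coeff s c)%:~R = coeff s d) -> change_coefficients K c = d.
Proof. by move=> cd; apply/eqP/freeg_eqP => s; rewrite coeff_change cd. Qed.

Lemma changeD (c d : chain R M int n) : change_coefficients K (c + d) =
  change_coefficients K c + change_coefficients K d.
Proof. by apply: change_eq => s; rewrite !coeffD !coeff_change intrD. Qed.

Lemma changeZ k (c : chain R M int n) :
  change_coefficients K (k *: c) = k%:~R *: change_coefficients K c.
Proof. by apply: change_eq => s; rewrite !coeffZ coeff_change intrM. Qed.

Lemma change0 : change_coefficients K (0 : chain R M int n) = 0.
Proof. by apply: change_eq => s; rewrite !coeff0. Qed.

Lemma changeU (s : singular_simplex R M n) :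
  change_coefficients K (<< s >> : chain R M int n) = << s >>.
Proof. by apply: change_eq => t; rewrite !coeffU !mul1r; case: eqP. Qed.

Lemma change_sum m (a : 'I_m -> int) (s : 'I_m -> singular_simplex R M n) :
  change_coefficients K (\sum_(j < m) << a j *g s j >>) =
  \sum_(j < m) << (a j)%:~R *g s j >>.
Proof.
apply: change_eq => t; rewrite !raddf_sum /=; apply: eq_bigr => j _.
by rewrite !coeffU intrM; case: eqP.
Qed.

End Ring.

Lemma change_rat_inj : injective (@change_coefficients R n M rat).
Proof.
move=> c d cd; apply/eqP/freeg_eqP => s; apply: (@intr_inj rat).
by rewrite -!coeff_change cd.
Qed.

Lemma chain_scale_inj (k : int) (c : chain R M int n) : k != 0 -> k *: c = 0 -> c = 0.
Proof.
move=> k0 kc; apply/eqP/freeg_eqP => s; rewrite coeff0; apply/eqP.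
have := congr1 (coeff s) kc; rewrite coeffZ coeff0 => /eqP.
by rewrite mulf_eq0 (negbTE k0).
Qed.

Lemma change_Fp_surj p (d : chain R M 'F_p n) :
  exists c : chain R M int n, change_coefficients 'F_p c = d.
Proof.
elim/(@freeg_ind_dom0 'F_p (singular_simplex R M n)): d => [|k s d _ _ [c cd]].
  by exists 0; exact: change0.
exists (Fp_lift k *: << s >> + c).
by rewrite changeD changeZ changeU cd Fp_liftK -freegUZ.
Qed.

Lemma change_Fp_eq0 p (c : chain R M int n) : prime p ->
  change_coefficients 'F_p c = 0 -> exists e : chain R M int n, c = p%:Z *: e.
Proof.
move=> pp c0; exists (\sum_(s <- dom c) << (coeff s c %/ p%:Z)%Z *g s >>).
rewrite -[LHS]freeg_sumE scaler_sumr; apply: eq_bigr => s _.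
rewrite [RHS](_ : _ = << p%:Z * (coeff s c %/ p%:Z)%Z *g s >>); last first.
  by apply/eqP/freeg_eqP => t; rewrite coeffZ !coeffU mulrA.
congr (<< _ *g _ >>); rewrite mulrC divzK //.
have := congr1 (coeff s) c0; rewrite coeff_change coeff0 => /eqP.
by rewrite intr_Fp_eq0.
Qed.

Lemma change_rat_denominator (d : chain R M rat n) :
  exists (D : int) (c : chain R M int n), D != 0 /\
    change_coefficients rat c = D%:~R *: d.
Proof.
elim/(@freeg_ind_dom0 rat (singular_simplex R M n)): d => [|k s d _ _ [D [c [D0 cd]]]].
  by exists 1, 0; rewrite change0 scaler0.
exists (denq k * D), ((D * numq k) *: << s >> + denq k *: c); split.
  by rewrite mulf_neq0 ?denq_neq0.
rewrite changeD !changeZ changeU cd scalerDr scalerA -intrM; congr (_ + _).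
rewrite freegUZ scalerA !intrM [_ * D%:~R]mulrC -mulrA; congr ((_ * _) *: _).
by rewrite -{3}[k]divq_num_den mulrC divfK // intr_eq0 denq_neq0.
Qed.

End ChangeCoefficients.

Lemma change_boundary (R : realType) (M : topologicalType) (K : comNzRingType) n
    (c : chain R M int n.+1) :
  boundary (change_coefficients K c) = change_coefficients K (boundary c).
Proof.
elim/(@freeg_lin_ind int (singular_simplex R M n.+1)): c => [|c d IHc IHd|k c IHc|s].
- by rewrite change0 !linear0 change0.
- by rewrite changeD !linearD changeD /= IHc IHd.
- by rewrite changeZ !linearZ changeZ /= IHc.
rewrite changeU !boundaryU.
elim: (index_enum _) => [|i r IHr]; first by rewrite !big_nil change0.
by rewrite !big_cons changeD changeZ changeU IHr rmorphXn rmorphN1.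
Qed.

(** * Lifting cycles with a bounded number of simplices *)

Section CycleLift.
Context {R : realType} {M : topologicalType}.

(** The pattern of a family of simplices records which of their faces coincide;
    it takes finitely many values when the number of simplices is fixed. *)
Definition face_pattern n m (s : 'I_m -> singular_simplex R M n.+1) :
    {ffun ('I_n.+2 * 'I_m) * ('I_n.+2 * 'I_m) -> bool} :=
  [ffun ft => face ft.1.1 (s ft.1.2) == face ft.2.1 (s ft.2.2)].

Definition incidence n m (E : {ffun ('I_n.+2 * 'I_m) * ('I_n.+2 * 'I_m) -> bool})
    (j : 'I_m) (t : 'I_n.+2 * 'I_m) : int :=
  \sum_(i < n.+2) (-1) ^+ i * (E ((i, j), t))%:R.

(** Only the coefficients of the boundary on actual faces of the [s j] can be
    nonzero, so the cycle condition is a finite linear system determined by the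
    pattern. *)
Lemma boundary_sum_eq0 (K : comNzRingType) n m (x : 'I_m -> K)
    (s : 'I_m -> singular_simplex R M n.+1) :
  boundary (\sum_(j < m) << x j *g s j >>) = 0 <->
  (forall t, \sum_(j < m) x j * (incidence (face_pattern s) j t)%:~R = 0).
Proof.
have coeffE t : coeff t (boundary (\sum_(j < m) << x j *g s j >>)) =
    \sum_(j < m) x j * \sum_(i < n.+2) (-1) ^+ i * (face i (s j) == t)%:R.
  rewrite linear_sum raddf_sum /=; apply: eq_bigr => j _.
  rewrite freegUZ linearZ /= coeffZ boundaryU raddf_sum /=; congr (_ * _).
  by apply: eq_bigr => i _; rewrite coeffZ coeffU mul1r.
have coeff_face t : coeff (face t.1 (s t.2)) (boundary (\sum_(j < m) << x j *g s j >>)) =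
    \sum_(j < m) x j * (incidence (face_pattern s) j t)%:~R.
  rewrite coeffE; apply: eq_bigr => j _; congr (_ * _); rewrite rmorph_sum /=.
  apply: eq_bigr => i _; rewrite rmorphM rmorphXn rmorphN1 /= ffunE /=.
  by rewrite rmorph_nat.
split=> [b0 t|h]; first by rewrite -coeff_face b0 coeff0.
apply/eqP/freeg_eqP => t; rewrite coeff0.
have [[ij tE]|nt] := pselect (exists ij : 'I_n.+2 * 'I_m, face ij.1 (s ij.2) = t).
  by rewrite -tE coeff_face h.
rewrite coeffE big1 // => j _; rewrite big1 ?mulr0 // => i _.
case: eqP => [ft|]; last by rewrite mulr0.
by case: nt; exists (i, j).
Qed.

Lemma cycle_lift n m : exists2 D : nat, (0 < D)%N &
  forall p, prime p -> ~~ (p %| D)%N ->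
  forall (a : 'I_m -> 'F_p) (s : 'I_m -> singular_simplex R M n),
    is_cycle (\sum_(j < m) << a j *g s j >>) ->
    exists2 b : 'I_m -> int, (forall j, (b j)%:~R = a j) &
      is_cycle (\sum_(j < m) << b j *g s j >>).
Proof.
case: n => [|n].
  exists 1%N => // p pp _ a s _; exists (fun j => Fp_lift (a j)) => // j.
  exact: Fp_liftK.
have /choice[D DP] := fun E => (let: ex_intro2 D D0 DE := kernel_lift (@incidence n m E)
  in ex_intro (fun D => (0 < D)%N /\ _) D (conj D0 DE)).
exists (\prod_E D E)%N; first by apply: prodn_gt0 => E; have [] := DP E.
move=> p pp pD a s /boundary_sum_eq0 cyc.
have [_ /(_ p pp _ a cyc)] := DP (face_pattern s).
case; first by apply: contra pD => pE; rewrite (bigD1 (face_pattern s)) //= dvdn_mulr.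
move=> b [ba bcyc]; exists b => //; apply/boundary_sum_eq0 => t.
by under eq_bigr do rewrite intz; exact: bcyc.
Qed.

End CycleLift.

(** * Comparing the coefficient fields *)

Section Comparison.
Context {R : realType} {n : nat} {M : topologicalType} (o : M -> chain R M int n).

Definition multiple_fundamental_cycle (d : int) m (a : 'I_m -> int)
    (s : 'I_m -> singular_simplex R M n) :=
  exists z b, integral_fundamental_cycle o z /\
    \sum_(j < m) << a j *g s j >> = d *: z + boundary b.

Lemma is_cycle_change (K : comNzRingType) (c : chain R M int n) :
  is_cycle c -> is_cycle (change_coefficients K c).
Proof.
by case: n c => //= k c c0; rewrite change_boundary c0 change0.
Qed.

Lemma is_cycle_boundary (K : comNzRingType) (b : chain R M K n.+1) :
  is_cycle (boundary b).
Proof. by case: n b => //= k b; exact: boundary_boundary. Qed.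

Lemma fundamental_of_multiple (K : fieldType) d m (a : 'I_m -> int)
    (s : 'I_m -> singular_simplex R M n) :
  d%:~R != 0 :> K -> multiple_fundamental_cycle d a s ->
  has_fundamental_cycle_of_length o K m.
Proof.
move=> dK [z [b [zf Cz]]]; pose D : K := d%:~R.
exists (fun j => D^-1 * (a j)%:~R), s.
have -> : \sum_(j < m) << D^-1 * (a j)%:~R *g s j >> =
    change_coefficients K z + boundary (D^-1 *: change_coefficients K b).
  rewrite [LHS](_ : _ = D^-1 *: change_coefficients K (\sum_(j < m) << a j *g s j >>)).
    rewrite Cz changeD changeZ scalerDr scalerA mulVf // scale1r.
    by rewrite -change_boundary linearZ.
  rewrite change_sum scaler_sumr; apply: eq_bigr => j _.
  by rewrite freegUZ [in RHS]freegUZ scalerA.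
split.
  rewrite -[boundary _]opprK; apply: is_cycleB; first by apply: is_cycle_change; case: zf.
  by rewrite -linearN; exact: is_cycle_boundary.
exists z => //; exists (D^-1 *: change_coefficients K b).
by rewrite addrC addKr.
Qed.

Lemma common_denominator m (a : 'I_m -> rat) :
  exists2 D : int, D != 0 & exists b : 'I_m -> int, forall j, (b j)%:~R = D%:~R * a j.
Proof.
exists (\prod_j denq (a j)); first by apply/prodf_neq0 => j _; exact: denq_neq0.
exists (fun j => (\prod_(i < m | i != j) denq (a i)) * numq (a j)) => j.
rewrite [\prod_j _](bigD1 j) //= !intrM -mulrA mulrCA; congr (_ * _).
by rewrite -{3}[a j]divq_num_den mulrCA divff ?mulr1 // intr_eq0 denq_neq0.
Qed.

Lemma multiple_of_rational m : has_fundamental_cycle_of_length o rat m ->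
  exists (d : int) (a : 'I_m -> int) (s : 'I_m -> singular_simplex R M n),
    d != 0 /\ multiple_fundamental_cycle d a s.
Proof.
move=> [a [s [_ [z zf [b cz]]]]].
have [D1 D10 [a1 a1E]] := common_denominator a.
have [D2 [b2 [D20 b2E]]] := change_rat_denominator b.
exists (D1 * D2), (fun j => D2 * a1 j), s; split; first by rewrite mulf_neq0.
exists z, (D1 *: b2); split => //; apply: change_rat_inj.
rewrite change_sum changeD changeZ -change_boundary changeZ b2E.
have -> : \sum_(j < m) << (D2 * a1 j)%:~R *g s j >> =
    (D1 * D2)%:~R *: \sum_(j < m) << a j *g s j >>.
  rewrite scaler_sumr; apply: eq_bigr => j _.
  by rewrite freegUZ [in RHS]freegUZ scalerA !intrM a1E mulrA [D2%:~R * _]mulrC.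
have -> : \sum_(j < m) << a j *g s j >> = change_coefficients rat z + boundary b.
  by rewrite -cz addrC subrK.
by rewrite scalerDr; congr (_ + _); rewrite !linearZ /= scalerA intrM.
Qed.

Context (hM : closed_connected_manifold R n M) (ho : is_orientation o).

(** A cycle over [F_p] lifts to an integral cycle [C] on the same simplices, and
    [C] represents a multiple of the fundamental class that is 1 modulo [p]. *)
Lemma multiple_of_Fp m : exists2 D : nat, (0 < D)%N &
  forall p, prime p -> ~~ (p %| D)%N -> has_fundamental_cycle_of_length o 'F_p m ->
  exists (d : int) (a : 'I_m -> int) (s : 'I_m -> singular_simplex R M n),
    d != 0 /\ multiple_fundamental_cycle d a s.
Proof.
have [D D0 DP] := @cycle_lift R M n m; exists D => // p pp pD.
move=> [a [s [cyca [z zf [b cz]]]]].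
have [a' a'E cyca'] := DP p pp pD a s cyca.
set C := \sum_(j < m) _ in cyca'.
have [b' b'E] := change_Fp_surj b.
have [|e eE] := @change_Fp_eq0 R M n p (C - z - boundary b') pp.
  rewrite -!scaleN1r !changeD !changeZ -change_boundary b'E -cz change_sum.
  under eq_bigr do rewrite a'E.
  by rewrite rmorphN1 !scaleN1r subrr.
have cyce : is_cycle e.
  have : is_cycle (p%:Z *: e).
    rewrite -eE; apply: is_cycleB; last exact: is_cycle_boundary.
    by apply: is_cycleB => //; case: zf.
  have p0 : p%:Z != 0 by case: p pp {DP pD a cyca b cz a'E b'E eE}.
  case: n e {eE} => //= k e; rewrite linearZ /=; exact: chain_scale_inj.
have [k [f ef]] := cycle_multiple_fundamental hM ho zf cyce.
exists (1 + p%:Z * k), a', s; split.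
  apply/eqP => pk; have : (p %| 1)%N.
    have := congr1 (fun x : int => (x%:~R : 'F_p)) pk.
    rewrite intrD intrM mulr0z => /eqP.
    by rewrite -[p%:~R]pmulrn (pchar_Fp_0 pp) mul0r addr0 oner_eq0.
  by rewrite dvdn1 => /eqP p1; rewrite p1 in pp.
exists z, (b' + p%:Z *: f); split => //; rewrite -/C.
have -> : C = z + boundary b' + p%:Z *: e.
  by rewrite -eE -[C - z - _]addrA -opprD subrKC.
have -> : boundary (b' + p%:Z *: f) = boundary b' + p%:Z *: boundary f.
  by rewrite linearD linearZ.
rewrite ef scalerDr scalerA scalerDl scale1r.
by rewrite [LHS](AC (2*2) ((1*3)*(2*4))).
Qed.

End Comparison.

Lemma weightless_simplicial_volumeP (R : realType) (n : nat) (M : topologicalType)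
    (o : M -> chain R M int n) (K : comNzRingType) m :
  has_fundamental_cycle_of_length o K m ->
  has_fundamental_cycle_of_length o K (weightless_simplicial_volume o K) /\
  forall m', has_fundamental_cycle_of_length o K m' ->
    (weightless_simplicial_volume o K <= m')%N.
Proof.
move=> Km; rewrite /weightless_simplicial_volume; set P := [set _ | _].
have [|] := @xgetPex _ 0%N P; last by [].
have exP : exists m, `[< has_fundamental_cycle_of_length o K m >].
  by exists m; apply/asboolP.
exists (ex_minn exP); case: ex_minnP => k /asboolP Kk kmin; split => // m' Km'.
by apply: kmin; exact/asboolP.
Qed.

Lemma exists_fundamental_length (R : realType) (n : nat) (M : topologicalType)
    (o : M -> chain R M int n) (K : fieldType) z :
  integral_fundamental_cycle o z ->
  has_fundamental_cycle_of_length o K (size (dom z)).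
Proof.
move=> zf; pose s := tnth (in_tuple (dom z)).
apply: (@fundamental_of_multiple _ _ _ o K 1 _ (fun j => coeff (s j) z) s).
  exact: oner_neq0.
exists z, 0; split => //; rewrite scale1r linear0 addr0.
by rewrite -[RHS]freeg_sumE [RHS]big_tnth.
Qed.

Theorem theorem1p2 (R : realType) (n : nat) (M : topologicalType)
    (o : M -> chain R M int n)
    (hM : closed_connected_manifold R n M) (ho : is_orientation o) :
  finite_set [set p : nat | prime p /\
    weightless_simplicial_volume o 'F_p <> weightless_simplicial_volume o rat].
Proof.
have [[z zf]|noz] := pselect (exists z, integral_fundamental_cycle o z); last first.
  have noK (K : comNzRingType) m : ~ has_fundamental_cycle_of_length o K m.
    by move=> [a [s [_ [z zf _]]]]; apply: noz; exists z.
  apply: (@sub_finite_set _ _ set0) => [p [_]|]; last exact: finite_set0.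
  case; rewrite /weightless_simplicial_volume.
  by congr xget; apply/seteqP; split=> m [] /noK.
have lenK := fun K : fieldType => exists_fundamental_length K zf.
set q := weightless_simplicial_volume o rat.
have [Qq Qmin] := weightless_simplicial_volumeP (lenK rat).
have [d [a [s [d0 ds]]]] := multiple_of_rational Qq.
have /choice[D DP] := fun m => (let: ex_intro2 D D0 DE := multiple_of_Fp hM ho m
  in ex_intro (fun D => (0 < D)%N /\ _) D (conj D0 DE)).
(* Every excluded prime divides X, hence is at most X. *)
pose X := (absz d * \prod_(m < q) D m)%N.
have X0 : (0 < X)%N.
  by rewrite muln_gt0 absz_gt0 d0 prodn_gt0 // => m; have [] := DP m.
apply: (@sub_finite_set _ _ `I_X.+1); last exact: finite_II.
move=> p [pp]; apply: contra_notT => pX.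
have {pX} pX : ~~ (p %| X)%N.
  by apply: contra pX => /(dvdn_leq X0) pX; rewrite /= ltnS.
have Fq : has_fundamental_cycle_of_length o 'F_p q.
  apply: (fundamental_of_multiple (d := d) (a := a) (s := s)) => //.
  by rewrite intr_Fp_eq0 //; apply: contra pX => pd; rewrite dvdn_mulr.
have [Fv Fmin] := weightless_simplicial_volumeP Fq.
apply/eqP; rewrite eqn_leq Fmin //= leqNgt; apply/negP => vq.
set v := weightless_simplicial_volume o 'F_p in Fv vq.
have [_ /(_ p pp _ Fv)] := DP v.
case.
  apply: contra pX => pDv.
  by rewrite dvdn_mull // (bigD1 (Ordinal vq)) //= dvdn_mulr.
move=> d' [a' [s' [d'0 ds']]].
have /Qmin : has_fundamental_cycle_of_length o rat v.
  by apply: fundamental_of_multiple ds'; rewrite intr_eq0.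
by rewrite leqNgt vq.
Qed.
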